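(* Let $E$ be a Fréchet locally convex space which is a quojection. Then $E$ endowed with its weak topology is an Ascoli space if and only if $E$ is either finite-dimensional or isomorphic (as a topological vector space) to the product $\mathbb{K}^{\mathbb{N}}$, where $\mathbb{K}\in\{\mathbb{R},\mathbb{C}\}$.
   Context: A Fréchet locally convex space is a metrizable and complete locally convex space; $\mathbb{K}$ is its scalar field. A Fréchet locally convex space $E$ is a quojection if it is isomorphic to the projective limit of a sequence of Banach spaces with surjective (continuous linear) linking maps; equivalently, if every quotient of $E$ which admits a continuous norm is a Banach space. For a topological space $Z$, $C_k(Z)$ denotes the space of all continuous functions $Z\to\mathbb{R}$ endowed with the compact-open topology. A subset $\mathcal{K}\subset C_k(Z)$ is evenly continuous if the evaluation map $(z,f)\mapsto f(z)$ restricted to $Z\times\mathcal{K}$ is jointly continuous, i.e. for every $z\in Z$, every $f\in\mathcal{K}$ and every neighborhood $O$ of $f(z)$ in $\mathbb{R}$ there are neighborhoods $U_f\subset\mathcal{K}$ of $f$ (in $\mathcal{K}$) and $O_z\subset Z$ of $z$ such that $g(y)\in O$ for all $g\in U_f$, $y\in O_z$. A Tychonoff space $Z$ is called an Ascoli space if every compact subset of $C_k(Z)$ is evenly continuous. *)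

(* Defs.v *)
From HB Require Import structures.
From mathcomp Require Import all_boot all_order all_algebra.
From mathcomp Require Import complex.
From mathcomp Require Import all_classical all_reals all_analysis.

Set Implicit Arguments.
Unset Strict Implicit.
Unset Printing Implicit Defensive.

Import Order.TTheory GRing.Theory Num.Theory.
Import numFieldTopology.Exports numFieldNormedType.Exports.

Local Open Scope classical_set_scope.
Local Open Scope ring_scope.

Definition homeomorphism (S T : topologicalType) (f : S -> T) : Prop :=
  exists g : T -> S,
    [/\ cancel f g, cancel g f, continuous f & continuous g].

Definition metrizable (R : realType) (T : topologicalType) : Prop :=
  exists (M : metricType R) (f : T -> M), homeomorphism f.

Definition tvs_isomorphic (K : numFieldType) (E F : preTopologicalLmodType K) :
    Prop :=
  exists f : {linear E -> F}, homeomorphism f.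

Definition finite_dimensional (K : numFieldType) (E : lmodType K) : Prop :=
  exists (n : nat) (f : {linear E -> 'rV[K]_n}), bijective f.

(* A [tvsType] carries a uniform structure that induces its topology but that
   is not required to be the translation-invariant one; the Cauchy filters of a
   topological vector space are those of the translation-invariant uniformity,
   so they are defined here from the neighborhoods of 0. *)
Definition tvs_cauchy (K : numFieldType) (E : tvsType K) (F : set_system E) :
    Prop :=
  forall U : set E, nbhs 0 U ->
    exists2 A : set E, F A & forall x y, A x -> A y -> U (x - y).

Definition tvs_complete (K : numFieldType) (E : tvsType K) : Prop :=
  forall F : set_system E, ProperFilter F -> tvs_cauchy F ->
    exists x : E, F --> x.

Definition frechet (R : realType) (K : numFieldType) (E : tvsType K) : Prop :=
  metrizable R E /\ tvs_complete E.

Section ProductLmodule.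
Context (K : numFieldType) (I : Type) (V : I -> preTopologicalLmodType K).
Local Notation P := (prod_topology V).

Let zero : P := fun=> 0.
Let opp (x : P) : P := fun i => - x i.
Let add (x y : P) : P := fun i => x i + y i.
Let scale (a : K) (x : P) : P := fun i => a *: x i.

Let addA : associative add.
Proof. by move=> x y z; apply: functional_extensionality_dep => i; exact: addrA. Qed.
Let addC : commutative add.
Proof. by move=> x y; apply: functional_extensionality_dep => i; exact: addrC. Qed.
Let add0 : left_id zero add.
Proof. by move=> x; apply: functional_extensionality_dep => i; exact: add0r. Qed.
Let addN : left_inverse zero opp add.
Proof. by move=> x; apply: functional_extensionality_dep => i; exact: addNr. Qed.

HB.instance Definition _ := GRing.isZmodule.Build P addA addC add0 addN.

Let scaleA a b x : scale a (scale b x) = scale (a * b) x.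
Proof. by apply: functional_extensionality_dep => i; exact: scalerA. Qed.
Let scale1 : left_id 1 scale.
Proof. by move=> x; apply: functional_extensionality_dep => i; exact: scale1r. Qed.
Let scaleDr : right_distributive scale +%R.
Proof. by move=> a x y; apply: functional_extensionality_dep => i; exact: scalerDr. Qed.
Let scaleDl x : {morph scale^~ x : a b / a + b}.
Proof. by move=> a b; apply: functional_extensionality_dep => i; exact: scalerDl. Qed.

HB.instance Definition _ :=
  GRing.Zmodule_isLmodule.Build K P scaleA scale1 scaleDr scaleDl.

End ProductLmodule.

Section ProjectiveLimit.
Context (K : numFieldType) (V : nat -> preTopologicalLmodType K).
Context (f : forall n, {linear V n.+1 -> V n}).

Definition threads : {pred prod_topology V} :=
  fun x => `[< forall n, f n (x n.+1) = x n >].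

Lemma threads_submod : submod_closed threads.
Proof.
split=> [|a x y /asboolP xP /asboolP yP]; apply/asboolP => n.
  exact: linear0.
by rewrite [LHS]linearP xP yP.
Qed.

HB.instance Definition _ :=
  GRing.isSubmodClosed.Build K (prod_topology V) threads threads_submod.

Record projlim := ProjLim {
  projlim_val : prod_topology V ;
  projlim_valP : projlim_val \in threads }.

HB.instance Definition _ := [isSub for projlim_val].
HB.instance Definition _ := [Choice of projlim by <:].
HB.instance Definition _ := [SubChoice_isSubLmodule of projlim by <:].
HB.instance Definition _ :=
  Topological.copy projlim (initial_topology projlim_val).

End ProjectiveLimit.

Definition quojection (K : numFieldType) (E : tvsType K) : Prop :=
  exists (X : nat -> completeNormedModType K)
         (f : forall n, {linear X n.+1 -> X n}),
    [/\ forall n, continuous (f n),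
        forall n, range (f n) = [set: X n] &
        tvs_isomorphic E (@projlim K (fun n => X n) f)].

Definition dual (K : numFieldType) (E : tvsType K) :=
  {f : {linear E -> K^o} | continuous f}.

Definition weak (K : numFieldType) (E : tvsType K) : Type := E.

HB.instance Definition _ (K : numFieldType) (E : tvsType K) :=
  Topological.copy (weak E)
    (sup_topology (fun f : dual E =>
       Topological.class (initial_topology (sval f : E -> K^o)))).

Definition tychonoff_space (T : topologicalType) : Prop :=
  completely_regular_space T /\ hausdorff_space T.

Definition Ck (R : realType) (Z : topologicalType) : Type := continuousType Z R.

HB.instance Definition _ (R : realType) (Z : topologicalType) :=
  Topological.copy (Ck R Z)
    (initial_topology
      (fun f : continuousType Z R => (f : {compact-open, Z -> R}))).

Definition evenly_continuous (R : realType) (Z : topologicalType)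
    (A : set (Ck R Z)) : Prop :=
  {within [set: Z] `*` A,
    continuous (fun zf : Z * Ck R Z => (zf.2 : continuousType Z R) zf.1)}.

Definition ascoli_space (R : realType) (Z : topologicalType) : Prop :=
  tychonoff_space Z /\
  forall A : set (Ck R Z), compact A -> evenly_continuous A.

Definition countable_power (K : numFieldType) : preTopologicalLmodType K :=
  prod_topology (fun _ : nat => (K^o : preTopologicalLmodType K)).

(* Main.v *)
Require Import Defs.
From HB Require Import structures.
From mathcomp Require Import all_boot all_order all_algebra.
From mathcomp Require Import complex ring lra.
From mathcomp Require Import all_classical all_reals all_analysis.

(** If the weak topology of [E] is that of a countable product of lines, or of
    a finite one, then every point has a countable base of neighborhoods cut
    out by continuous functions. A space with this property is Ascoli: were a
    compact set of functions not evenly continuous at [z], a sequence of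
    functions and a sequence of points converging to [z] would witness it, and
    a cluster point of the functions, tested against the compact set formed by
    the points and [z], gives a contradiction.

    Conversely let the weak topology be Ascoli, and let [p n] be the norm of
    the n-th projection of the quojection [E]. The heart of the proof is that
    only a finite-dimensional space of functionals is bounded by multiples of
    [p n]. Otherwise there are infinitely many independent functionals [v i]
    with [|v i| <= p n], and the functions
    [h k = \sum_(i <= k) max (|v i| - k, 0)] are weakly continuous. On a
    weakly compact set the [v i] are uniformly bounded
    ([uniformly_bounded]), so [h k] vanishes there for large [k]; hence the
    [h k] together with 0 form a compact set of functions. But a weak
    neighborhood of 0 contains the common kernel of finitely many functionals,
    on which some [v i] with [i <= k] is nonzero as soon as [k] is large, so
    that [h k] takes large values there, and even continuity fails at 0
    ([infinite_biorthogonal_not_ascoli]).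

    By the Hahn-Banach theorem ([hahn_banach]) the functionals bounded by
    [p n] separate the points of the image of [E] in the n-th Banach space. A
    biorthogonal sequence whose initial segments span the successive spaces of
    bounded functionals ([exists_spanning_tower]) then serves as a system of
    coordinates: it identifies [E] with a finite power of the scalar field if
    the dimensions are bounded, and with the countable power otherwise, every
    family of coordinates being realized by a thread of the projective limit.

    Real and complex scalars are treated at once by means of the structure
    [real_scalars]. *)

Set Implicit Arguments.
Unset Strict Implicit.
Unset Printing Implicit Defensive.

Import Order.TTheory GRing.Theory Num.Theory.
Import numFieldTopology.Exports numFieldNormedType.Exports.

Local Open Scope classical_set_scope.
Local Open Scope ring_scope.

(** * Minimal sublinear functionals and the real Hahn-Banach theorem *)

Section LinearPack.
Context (K : nzRingType) (V W : lmodType K) (f : V -> W) (lf : linear f).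

Let linear_pack_fun := f.
HB.instance Definition _ := GRing.isLinear.Build K V W *:%R linear_pack_fun lf.

(** The linear map with a given underlying function. *)
Definition linear_pack : {linear V -> W} := linear_pack_fun.

Lemma linear_packE x : linear_pack x = f x. Proof. by []. Qed.

End LinearPack.

Section SublinearFunctionals.
Context (R : realType) (V : lmodType R).
Implicit Types (p q : V -> R) (x y : V).

(** Subadditive and positively homogeneous functionals. *)
Definition sublinear p :=
  (forall x y, p (x + y) <= p x + p y) /\
  (forall r x, 0 <= r -> p (r *: x) = r * p x).

Lemma sublinear0 p : sublinear p -> p 0 = 0.
Proof. by move=> [_ /(_ 0 0 (lexx 0))]; rewrite scale0r mul0r. Qed.

Lemma sublinear_opp_ge p x : sublinear p -> - p (- x) <= p x.
Proof.
move=> sp; have := sp.1 x (- x); rewrite subrr (sublinear0 sp).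
by move: (p (- x)) (p x) => a b; lra.
Qed.

(** For a minimal [p] this forces [q = p], and the last inequality then makes
    [p] odd. *)
Lemma sublinear_shift p y : sublinear p ->
  exists q, [/\ sublinear q, forall x, q x <= p x & q (- y) <= - p y].
Proof.
move=> sp; have [pD pZ] := sp.
(* The functional sought is the infimum of [p (x + t y) - t p y], [t >= 0]. *)
pose A x := [set p (x + t *: y) - t * p y | t in [set t : R | 0 <= t]].
have lbA x : lbound (A x) (- p (- x)).
  move=> _ [t t0 <-]; have := pD (x + t *: y) (- x).
  rewrite addrAC subrr add0r pZ//.
  by move: (p (- x)) (p y) (p (_ + _)) => a b c h; lra.
have A0 x : A x !=set0 by exists (p (x + 0 *: y) - 0 * p y); exists 0 => /=.
have hlb x : has_lbound (A x) by exists (- p (- x)); exact: lbA.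
have infle x t : 0 <= t -> inf (A x) <= p (x + t *: y) - t * p y.
  by move=> t0; apply: ge_inf => //; exists t.
have leinf x z : (forall t, 0 <= t -> z <= p (x + t *: y) - t * p y) ->
    z <= inf (A x).
  by move=> h; apply: lb_le_inf => // _ [t t0 <-]; exact: h.
have q0 : inf (A 0) = 0.
  apply/eqP; rewrite eq_le; apply/andP; split.
    by have := infle 0 0 (lexx _); rewrite scale0r mul0r addr0 subr0 (sublinear0 sp).
  by apply: (leinf) => t t0; rewrite add0r pZ// subrr.
exists (fun x => inf (A x)); split; last first.
- by have := infle (- y) 1 ler01; rewrite scale1r addNr mul1r (sublinear0 sp) sub0r.
- by move=> x; have := infle x 0 (lexx _); rewrite scale0r mul0r addr0 subr0.
split=> [x x'|r x].
  rewrite -lerBlDr; apply: (leinf) => t t0; rewrite lerBlDr -lerBlDl.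
  apply: (leinf) => s s0; rewrite lerBlDl.
  apply: le_trans (infle _ (t + s) (addr_ge0 t0 s0)) _.
  have := pD (x + t *: y) (x' + s *: y).
  rewrite addrACA -scalerDl.
  by move: (p (_ + _)) (p (x + _)) (p (x' + _)) (p y) => a b c e h; lra.
rewrite le_eqVlt => /orP[/eqP <-|r0]; first by rewrite scale0r mul0r q0.
apply/eqP; rewrite eq_le; apply/andP; split.
  rewrite mulrC -ler_pdivrMr//; apply: (leinf) => t t0; rewrite ler_pdivrMr//.
  apply: le_trans (infle _ (r * t) _) _; first by rewrite mulr_ge0// ltW.
  by rewrite -scalerA -scalerDr pZ ?(ltW r0)// -mulrA -mulrBr mulrC.
apply: (leinf) => t t0; have := infle x (r^-1 * t) _.
rewrite mulr_ge0 ?invr_ge0 ?(ltW r0)// => /(_ isT) h.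
apply: le_trans (ler_wpM2l (ltW r0) h) _.
by rewrite mulrBr -(pZ r) ?(ltW r0)// scalerDr !scalerA !mulrA mulfV ?mul1r// gt_eqF.
Qed.

(** Every sublinear functional dominates a linear one: a sublinear functional
    that is minimal below [p] is linear. *)
Lemma sublinear_ge_linear p : sublinear p ->
  exists f : {linear V -> R^o}, forall x, f x <= p x.
Proof.
move=> sp.
pose T := {q : V -> R | sublinear q /\ forall x, q x <= p x}.
pose below (q q' : T) := `[< forall x, sval q' x <= sval q x >].
have [|||A totA|q qmin] := @Zorn T below.
- by move=> q; apply/asboolP.
- by move=> q r s /asboolP h /asboolP h'; apply/asboolP => x; exact: le_trans (h' x) (h x).
- move=> [q hq] [r hr] /asboolP /= h /asboolP /= h'.
  have qr : q = r by apply/funext => x; apply/eqP; rewrite eq_le h h'.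
  by case: _ / qr hr {h h'} => hr; congr exist; exact: Prop_irrelevance.
- (* The pointwise infimum of a nonempty chain is sublinear. *)
  have [[a Aa]|nA] := pselect (exists a, A a); last first.
    by exists (exist _ p (conj sp (fun x => lexx _))) => s As; case: nA; exists s.
  pose B x := [set sval s x | s in A].
  have B0 x : B x !=set0 by exists (sval a x); exists a.
  have hlb x : has_lbound (B x).
    exists (- p (- x)) => _ [[s [ss sleq]] As <-] /=.
    by apply: le_trans (sublinear_opp_ge x ss); rewrite lerN2.
  have infle s x : A s -> inf (B x) <= sval s x.
    by move=> As; apply: ge_inf => //; exists s.
  have sB : sublinear (fun x => inf (B x)).
    split=> [x y|r x r0].
      rewrite -lerBlDr; apply: lb_le_inf => // _ [s As <-]; rewrite lerBlDr -lerBlDl.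
      apply: lb_le_inf => // _ [s' As' <-]; rewrite lerBlDl.
      have [/asboolP h|/asboolP h] := totA _ _ As As'.
        apply: le_trans (infle s' _ As') _; apply: le_trans ((svalP s').1.1 _ _) _.
        by rewrite lerD2r.
      apply: le_trans (infle s _ As) _; apply: le_trans ((svalP s).1.1 _ _) _.
      by rewrite lerD2l.
    have [->|r1] := eqVneq r 0.
      rewrite scale0r mul0r; apply/eqP; rewrite eq_le; apply/andP; split.
        by apply: le_trans (infle a _ Aa) _; rewrite (sublinear0 (svalP a).1).
      by apply: lb_le_inf => // _ [s As <-]; rewrite (sublinear0 (svalP s).1).
    have {}r0 : 0 < r by rewrite lt_neqAle eq_sym r1.
    apply/eqP; rewrite eq_le; apply/andP; split.
      rewrite mulrC -ler_pdivrMr//; apply: lb_le_inf => // _ [s As <-].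
      rewrite ler_pdivrMr// mulrC -((svalP s).1.2) ?(ltW r0)//; exact: infle.
    apply: lb_le_inf => // _ [s As <-]; rewrite (svalP s).1.2 ?(ltW r0)//.
    by rewrite ler_pM2l//; exact: infle.
  have Bp x : inf (B x) <= p x by apply: le_trans (infle a _ Aa) _; exact: (svalP a).2.
  pose t : T := exist _ (fun x => inf (B x)) (conj sB Bp).
  by exists t => s As; apply/asboolP => x; exact: infle.
have [sq qp] := svalP q; set f := sval q in sq qp.
have fN y : f (- y) = - f y.
  have [q' [sq' q'f q'N]] := sublinear_shift y sq.
  pose Q : T := exist _ q' (conj sq' (fun x => le_trans (q'f x) (qp x))).
  have QE : Q = q by apply: qmin; apply/asboolP.
  have fq : q' = f by rewrite /f -QE.
  apply/eqP; rewrite eq_le -{1}fq q'N/=.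
  by rewrite lerNl; have := sublinear_opp_ge y sq.
have fD x y : f (x + y) = f x + f y.
  apply/eqP; rewrite eq_le sq.1/=.
  have := sq.1 (- x) (- y); rewrite -opprD !fN.
  by move: (f x) (f y) (f (x + y)) => a b c h; lra.
have fZ r x : f (r *: x) = r * f x.
  have [r0|r0] := leP 0 r; first exact: sq.2.
  rewrite -[r]opprK scaleNr fN sq.2 ?mulNr// oppr_ge0; exact: ltW.
have lf : linear (f : V -> R^o) by move=> a x y; rewrite fD fZ.
by exists (linear_pack lf) => x; rewrite linear_packE.
Qed.

Lemma real_hahn_banach p x0 : sublinear p ->
  exists2 f : {linear V -> R^o}, forall x, f x <= p x & f x0 = p x0 :> R.
Proof.
move=> sp; have [q [sq qp qx0]] := sublinear_shift x0 sp.
have [f fq] := sublinear_ge_linear sq.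
exists f => [x|]; first exact: le_trans (fq x) (qp x).
apply/eqP; rewrite eq_le (le_trans (fq _) (qp _))//=.
by have := le_trans (fq (- x0)) qx0; rewrite linearN lerN2.
Qed.

End SublinearFunctionals.

(** * Real and complex scalars *)

Lemma real_cauchy_cvg (R : realType) (s : nat -> R) :
  (forall e, 0 < e -> exists N, forall m n, (N <= m)%N -> (N <= n)%N ->
    `|s m - s n| < e) ->
  exists l, forall e, 0 < e -> exists N, forall n, (N <= n)%N -> `|s n - l| < e.
Proof.
move=> sC; have /cvg_ex [l sl] : cvgn s.
  apply/cauchy_cvgP/cauchy_exP => e /sC [N hN].
  exists (s N); exists N => // n /= Nn; rewrite -ball_normE /=.
  exact: hN.
exists l => e e0; have /cvgrPdist_lt /(_ e e0) [N _ hN] := sl.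
by exists N => n Nn; rewrite distrC; exact: hN.
Qed.

(** What the real and the complex numbers have in common, as scalar fields over
    the reals: an embedding of the reals, a real-valued modulus that induces
    the norm, completeness, and the extension of a dominated real-linear
    functional [u] to a scalar-linear functional [g] without new zeros. In the
    complex case [g x = u x - i u (i x)], whence the constant 2. *)
Record real_scalars (R : realType) (K : numFieldType) := RealScalars {
  of_real :> {rmorphism R -> K};
  modulus : K -> R;
  of_real_le : {mono of_real : r s / r <= s};
  of_modulus : forall z, of_real (modulus z) = `|z|;
  modulus_complete : forall s : nat -> K,
    (forall e, 0 < e -> exists N, forall m n, (N <= m)%N -> (N <= n)%N ->
      modulus (s m - s n) < e) ->
    exists l, forall e, 0 < e ->
      exists N, forall n, (N <= n)%N -> modulus (s n - l) < e;
  linear_extension : forall (V : lmodType K) (u p : V -> R),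
    (forall x y, u (x + y) = u x + u y) ->
    (forall r x, u (of_real r *: x) = r * u x) ->
    (forall a x, p (a *: x) = modulus a * p x) ->
    (forall x, u x <= p x) ->
    exists2 g : {linear V -> K^o}, forall x, modulus (g x) <= 2 * p x &
      forall x, g x = 0 -> u x = 0 }.

Lemma real_scalars_real (R : realType) : real_scalars R R.
Proof.
refine (@RealScalars R R idfun (fun z => `|z|) _ _ (@real_cauchy_cvg R) _) => //.
(* Over the reals [g] is [u] itself. *)
move=> V u p uD uZ pZ up.
have lu : linear (u : V -> R^o) by move=> a x y; rewrite uD uZ.
exists (linear_pack lu) => // x; rewrite linear_packE.
have h1 := up x; have := up (- x).
rewrite -scaleN1r (uZ (-1)) (pZ (-1)) normrN1 mul1r mulN1r => h2.
by rewrite ler_norml; move: (u x) (p x) h1 h2 => a b h1 h2; apply/andP; split; lra.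
Qed.

Section ComplexScalars.
Context (R : realType).
Local Notation C := (complex R).

Lemma complex_normE (z : C) :
  (real_complex R (Num.sqrt (complex.Re z ^+ 2 + complex.Im z ^+ 2))) = `|z|.
Proof. by rewrite normc_def. Qed.

Lemma sqrt_sum_squares_le (a b : R) : Num.sqrt (a ^+ 2 + b ^+ 2) <= `|a| + `|b|.
Proof.
rewrite -[leRHS]ger0_norm ?addr_ge0// -sqrtr_sqr ler_wsqrtr//.
rewrite sqrrD !real_normK ?num_real// -addrA [_ *+ 2 + _]addrC addrA lerDl.
by rewrite mulrn_wge0// mulr_ge0.
Qed.

Lemma ler_norm_sqrt_sum_squares (a b : R) : `|a| <= Num.sqrt (a ^+ 2 + b ^+ 2).
Proof. by rewrite -sqrtr_sqr ler_wsqrtr// lerDl sqr_ge0. Qed.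

Lemma real_scalars_complex : real_scalars R C.
Proof.
refine (@RealScalars R C (real_complex R)
  (fun z => Num.sqrt (complex.Re z ^+ 2 + complex.Im z ^+ 2)) _ _ _ _).
- by move=> r s; rewrite lecR.
- exact: complex_normE.
- move=> s sC.
  have [|a ha] := @real_cauchy_cvg R (fun n => complex.Re (s n)).
    move=> e /sC [N hN]; exists N => m n Nm Nn; apply: le_lt_trans (hN m n Nm Nn).
    rewrite -(raddfB (@complex.Re R)); exact: ler_norm_sqrt_sum_squares.
  have [|b hb] := @real_cauchy_cvg R (fun n => complex.Im (s n)).
    move=> e /sC [N hN]; exists N => m n Nm Nn; apply: le_lt_trans (hN m n Nm Nn).
    rewrite -(raddfB (@complex.Im R)) [_ ^+ 2 + _]addrC; exact: ler_norm_sqrt_sum_squares.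
  exists (Complex a b) => e e0.
  have e20 : 0 < e / 2 by rewrite divr_gt0.
  have [N hN] := ha _ e20; have [M hM] := hb _ e20.
  exists (maxn N M) => n; rewrite geq_max => /andP[Nn Mn].
  apply: le_lt_trans (sqrt_sum_squares_le _ _) _.
  rewrite (raddfB (@complex.Re R)) (raddfB (@complex.Im R)) /= [ltRHS]splitr.
  by rewrite ltrD// ?hN ?hM.
- move=> V u p uD uZ pZ up.
  have uN x : u (- x) = - u x.
    by have := uZ (-1) x; rewrite rmorphN1 scaleN1r mulN1r.
  pose i : C := Complex 0 1.
  have uC a b x : u (Complex a b *: x) = a * u x + b * u (i *: x).
    have -> : Complex a b = real_complex R a + real_complex R b * i.
      by apply/eqP; rewrite eq_complex /=; apply/andP; split; apply/eqP; ring.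
    by rewrite scalerDl uD uZ -scalerA uZ.
  pose g x : C := Complex (u x) (- u (i *: x)).
  have lg : linear (g : V -> C^o).
    move=> [a b] x y; apply/eqP; rewrite eq_complex /= scalerDr !uD scalerA.
    have -> : i * Complex a b = Complex (- b) a.
      by apply/eqP; rewrite eq_complex /=; apply/andP; split; apply/eqP; ring.
    rewrite (uC a b) (uC (- b) a); apply/andP; split; apply/eqP; ring.
  have modi : Num.sqrt (complex.Re i ^+ 2 + complex.Im i ^+ 2) = 1 :> R.
    by rewrite /= expr0n expr1n add0r sqrtr1.
  have upn x : `|u x| <= p x.
    rewrite ler_norml up andbT lerNl -uN; apply: le_trans (up _) _.
    rewrite -scaleN1r pZ /= oppr0 expr0n addr0 sqrrN expr1n sqrtr1 mul1r; exact: lexx.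
  exists (linear_pack lg) => x; rewrite linear_packE /=.
    apply: le_trans (sqrt_sum_squares_le _ _) _; rewrite normrN.
    have := upn (i *: x); rewrite pZ modi mul1r => h; have := upn x.
    by move: h; move: (p x) `|u x| `|u _| => a b c {modi}; lra.
  by move=> /eqP; rewrite eq_complex /= => /andP[/eqP].
Qed.

End ComplexScalars.

Lemma exists_real_scalars (R : realType) (K : numFieldType) :
  K = R :> numFieldType \/ K = complex R :> numFieldType ->
  inhabited (real_scalars R K).
Proof.
move=> [->|->]; apply: inhabits;
  [exact: real_scalars_real|exact: real_scalars_complex].
Qed.

(** * Seminorms, the Hahn-Banach theorem and uniform boundedness *)

(* Linear arithmetic on the goal alone, without the hypotheses of the context. *)
Local Ltac goal_lra := clear; intros; lra.

Section Modulus.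
Context (R : realType) (K : numFieldType) (S : real_scalars R K).
Implicit Types (a b z : K) (r : R).
Local Notation mod := (modulus S).

Lemma of_real_inj : injective (of_real S).
Proof. exact: fmorph_inj. Qed.

Lemma of_real_lt : {mono of_real S : r s / r < s}.
Proof. by move=> r s; rewrite !lt_def of_real_le (inj_eq of_real_inj). Qed.

Lemma modulus_ge0 z : 0 <= mod z.
Proof. by rewrite -(of_real_le S) rmorph0 of_modulus. Qed.

Lemma modulusM a b : mod (a * b) = mod a * mod b.
Proof. by apply: of_real_inj; rewrite rmorphM !of_modulus normrM. Qed.

Lemma modulusD a b : mod (a + b) <= mod a + mod b.
Proof. by rewrite -(of_real_le S) rmorphD !of_modulus ler_normD. Qed.

Lemma modulusN z : mod (- z) = mod z.
Proof. by apply: of_real_inj; rewrite !of_modulus normrN. Qed.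

Lemma modulus_distC a b : mod (a - b) = mod (b - a).
Proof. by rewrite -modulusN opprB. Qed.

Lemma modulusB_ge a b : mod a - mod b <= mod (a - b).
Proof. by have := modulusD (a - b) b; rewrite subrK lerBlDr. Qed.

Lemma modulus0 : mod 0 = 0.
Proof. by apply: of_real_inj; rewrite of_modulus normr0 rmorph0. Qed.

Lemma modulus_eq0 z : (mod z == 0) = (z == 0).
Proof. by rewrite -(inj_eq of_real_inj) of_modulus rmorph0 normr_eq0. Qed.

Lemma modulus_of_real r : mod (of_real S r) = `|r|.
Proof.
wlog r0 : r / 0 <= r => [h|].
  have [/h//|r0] := leP 0 r; rewrite -modulusN -rmorphN -normrN h// oppr_ge0.
  exact: ltW.
apply: of_real_inj; rewrite of_modulus !ger0_norm//.
by rewrite -(rmorph0 S) of_real_le.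
Qed.

Lemma modulus1 : mod 1 = 1.
Proof. by rewrite -(rmorph1 S) modulus_of_real normr1. Qed.

Lemma modulus_small a : (forall e, 0 < e -> mod a < e) -> a = 0.
Proof.
move=> h; apply/eqP; rewrite -modulus_eq0 eq_le modulus_ge0 andbT.
by apply/ler_addgt0Pl => e e0; rewrite addr0; exact/ltW/h.
Qed.

(** Positive elements of the scalar field are real. *)
Lemma pos_of_real (e : K) : 0 < e -> e = of_real S (mod e) /\ 0 < mod e.
Proof.
move=> e0; rewrite of_modulus gtr0_norm//; split=> //.
by rewrite -of_real_lt rmorph0 of_modulus gtr0_norm.
Qed.

End Modulus.

Section Seminorms.
Context (R : realType) (K : numFieldType) (S : real_scalars R K).
Context (V : lmodType K).
Implicit Types (p : V -> R) (x y : V).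
Local Notation mod := (modulus S).

(** Seminorms, with values in the reals. *)
Definition seminorm p :=
  (forall x y, p (x + y) <= p x + p y) /\
  (forall a x, p (a *: x) = mod a * p x).

(** [|f| <= p] pointwise. *)
Definition dominated p (f : V -> K) := forall x, mod (f x) <= p x.

Lemma seminorm0 p : seminorm p -> p 0 = 0.
Proof. by move=> [_ /(_ 0 0)]; rewrite scale0r modulus0 mul0r. Qed.

Lemma seminormN p x : seminorm p -> p (- x) = p x.
Proof. by move=> [_ pZ]; rewrite -scaleN1r pZ modulusN modulus1 mul1r. Qed.

Lemma seminorm_ge0 p x : seminorm p -> 0 <= p x.
Proof.
move=> sp; have := sp.1 x (- x); rewrite subrr (seminorm0 sp) seminormN//.
by rewrite -mulr2n pmulrn_lge0.
Qed.

(** Restriction of scalars from [K] to the reals. *)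
Definition real_module of real_scalars R K : Type := V.
Local Notation VR := (real_module S).
HB.instance Definition _ := GRing.Zmodule.on VR.
Let real_scale (r : R) (x : VR) : VR := of_real S r *: (x : V).
Let real_scaleA a b x : real_scale a (real_scale b x) = real_scale (a * b) x.
Proof. by rewrite /real_scale scalerA rmorphM. Qed.
Let real_scale1 : left_id 1 real_scale.
Proof. by move=> x; rewrite /real_scale rmorph1 scale1r. Qed.
Let real_scaleDr : right_distributive real_scale +%R.
Proof. by move=> a x y; exact: scalerDr. Qed.
Let real_scaleDl x : {morph real_scale^~ x : a b / a + b}.
Proof. by move=> a b; rewrite /real_scale rmorphD scalerDl. Qed.
HB.instance Definition _ := GRing.Zmodule_isLmodule.Build R VR
  real_scaleA real_scale1 real_scaleDr real_scaleDl.

(** The constant 2 comes from recovering a complex functional from its real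
    part; any constant would do. *)
Lemma hahn_banach p x0 : seminorm p -> p x0 != 0 ->
  exists2 g : {linear V -> K^o}, dominated (fun x => 2 * p x) g & g x0 <> 0.
Proof.
move=> [pD pZ] px0.
have sp : sublinear (p : VR -> R).
  by split=> // r x r0; have := pZ (of_real S r) x; rewrite modulus_of_real ger0_norm.
have [u up ux0] := real_hahn_banach (x0 : VR) sp.
have [|r x|||g gp gu] := @linear_extension R K S V u p.
- by move=> x y; rewrite -(raddfD u).
- by have := linearZ_LR u r (x : VR).
- by [].
- by [].
by exists g => // /gu; rewrite ux0 => /eqP; apply/negP.
Qed.

End Seminorms.

Section UniformBoundedness.
Context (R : realType) (K : numFieldType) (S : real_scalars R K).
Context (V : lmodType K) (p : V -> R) (sp : seminorm S p).
Local Notation mod := (modulus S).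
Local Notation dom f := (dominated S p f).

(** If every functional bounded by a multiple of [p] is bounded on [C], then
    the functionals dominated by [p] are uniformly bounded on [C]. Otherwise
    choose [f n] dominated by [p] and [x n] in [C] such that [f n (x n)] is huge
    and nearly maximal among the values at [x n] of dominated functionals. For
    suitable signs [s n] the functional [g = \sum_n s n * 3^-n * f n] is
    bounded by a multiple of [p]; at [x n] its n-th term beats the tail of the
    series, and its sign keeps it from cancelling the previous terms. So [g]
    is unbounded on [C]. *)
Lemma uniformly_bounded (C : set V) :
  (forall g : {linear V -> K^o}, (exists c, dominated S (fun x => c * p x) g) ->
    exists M, forall x, C x -> mod (g x) <= M) ->
  exists M, forall f : {linear V -> K^o}, dom f ->
    forall x, C x -> mod (f x) <= M.
Proof.
move=> Cbnd; apply: contrapT => nbnd.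
have /choice [w hw] : forall n : nat, exists fx : {linear V -> K^o} * V,
    [/\ dom fx.1, C fx.2, n%:R * 3 ^+ n < mod (fx.1 fx.2) &
        forall f : {linear V -> K^o}, dom f ->
          mod (f fx.2) <= 3 / 2 * mod (fx.1 fx.2)].
  (* [n * 3 ^ n] makes up for the coefficient [3 ^- n] of [f n]. *)
  move=> n; pose M : R := n%:R * 3 ^+ n.
  have M0 : 0 <= M by rewrite mulr_ge0// exprn_ge0.
  have [f0 [x [f0p Cx f0x]]] : exists (f : {linear V -> K^o}) x,
      [/\ dom f, C x & 3 / 2 * M < mod (f x)].
    apply: contrapT => h; apply: nbnd; exists (3 / 2 * M) => f fp x Cx.
    by rewrite leNgt; apply/negP => fx; apply: h; exists f, x.
  pose A := [set mod (f x) | f in [set f : {linear V -> K^o} | dom f]].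
  have A0 : A !=set0 by exists (mod (f0 x)); exists f0.
  have ubA : has_ubound A by exists (p x) => _ [f fp <-]; exact: fp.
  have supge (f : {linear V -> K^o}) : dom f -> mod (f x) <= sup A.
    by move=> fp; apply: sup_ubound => //; exists f.
  have sM : 3 / 2 * M < sup A by exact: lt_le_trans f0x (supge _ f0p).
  have [|_ [f fp <-] fx] := @sup_adherent R A (sup A / 3) _ (conj A0 ubA).
    by rewrite divr_gt0// (le_lt_trans _ sM)// mulr_ge0.
  exists (f, x); split=> //=.
    move: sM fx; rewrite /M; move: (sup A) (mod (f x)) (n%:R * _); goal_lra.
  move=> g gp; have := supge g gp.
  by move: fx; move: (sup A) (mod (f x)) (mod (g x)); goal_lra.
pose f n := (w n).1; pose x n := (w n).2.
pose t n : K := of_real S (3^-1 ^+ n).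
have t0 n : 0 <= 3^-1 ^+ n :> R by rewrite exprn_ge0// invr_ge0.
have modt n z : mod (t n * z) = 3^-1 ^+ n * mod z.
  by rewrite modulusM modulus_of_real ger0_norm.
(* Partial sums, with the signs chosen one after the other. *)
pose F := fix F n : V -> K := if n is m.+1 then
    let s : K := if 3^-1 ^+ m * mod (f m (x m)) <= mod (F m (x m) + t m * f m (x m))
             then 1 else -1 in
    fun y => F m y + s * (t m * f m y)
  else fun=> 0.
have FS n : exists s : K, [/\ mod s = 1, forall y, F n.+1 y = F n y + s * (t n * f n y)
    & 3^-1 ^+ n * mod (f n (x n)) <= mod (F n.+1 (x n))].
  rewrite /=; case: ifPn => h; [exists 1|exists (-1)].
    by split; rewrite ?modulus1 ?mul1r.
  split; rewrite ?modulusN ?modulus1// mulN1r.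
  have := modulusD S (- (F n (x n) - t n * f n (x n))) (F n (x n) + t n * f n (x n)).
  rewrite (_ : - _ + _ = 2 * (t n * f n (x n))); last first.
    by move: (F n _) (t n * _) => u v; ring.
  rewrite (modulusM S 2) modulusN modt.
  have -> : mod 2 = 2 by rewrite -(rmorph_nat S 2) modulus_of_real ger0_norm.
  move: h; rewrite -ltNge; set a := _ * mod (f n _).
  by move: (mod _) (mod _) a; goal_lra.
have Flin n a y z : F n (a *: y + z) = a * F n y + F n z.
  elim: n => [|n IH]; first by rewrite /= mulr0 addr0.
  have [s [_ FE _]] := FS n; rewrite !FE IH linearP /=.
  rewrite /GRing.scale /=.
  by move: (F n y) (F n z) (f n y) (f n z) (t n) => u v u' v' k; ring.
have Fdist B y n m : (n <= m)%N ->
    (forall k, mod (f k y) <= B) ->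
    mod (F m y - F n y) <= 3 / 2 * (3^-1 ^+ n - 3^-1 ^+ m) * B.
  move=> nm hB; have [k ->] : exists k, m = (n + k)%N by exists (m - n)%N; rewrite subnKC.
  elim: k => [|k IH]; first by rewrite addn0 !subrr modulus0 mulr0 mul0r.
  have [s [s1 FE _]] := FS (n + k)%N; rewrite addnS FE addrAC.
  apply: le_trans (modulusD _ _ _) _; rewrite modulusM s1 mul1r modt.
  have := ler_wpM2l (t0 (n + k)%N) (hB (n + k)%N); move: IH; rewrite exprS.
  move: (mod _) (mod (f _ _)) (3^-1 ^+ (n + k)) (3^-1 ^+ n) => a b c d h h'.
  rewrite -[leRHS](_ : 3 / 2 * (d - c) * B + c * B = _); first exact: lerD.
  by field.
have Flim y : exists l, forall e, 0 < e ->
    exists N, forall n, (N <= n)%N -> mod (F n y - l) < e.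
  apply: (modulus_complete (r := S)) => e e0.
  have p0 : 0 < 1 + p y by rewrite ltr_pwDl// (seminorm_ge0 _ sp).
  have [N hN] : exists N : nat, forall n, (N <= n)%N -> 3^-1 ^+ n < e / 3 / (1 + p y).
    have h3 : `|3^-1 : R| < 1 by rewrite ger0_norm ?invr_ge0// invf_lt1 ?ltr1n.
    have e30 : 0 < e / 3 / (1 + p y) by rewrite !divr_gt0.
    have /cvgrPdist_lt/(_ _ e30) [N _ hN] := cvg_expr h3.
    by exists N => n /hN; rewrite /= sub0r normrN ger0_norm.
  have FN m : (N <= m)%N -> mod (F m y - F N y) < e / 2.
    move=> Nm; have := Fdist (1 + p y) y N m Nm.
    move=> /(_ _)/le_lt_trans; apply.
      move=> k; have [fp _ _ _] := hw k; apply: le_trans (fp y) _.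
      by rewrite lerDr.
    have := hN N (leqnn _); rewrite ltr_pdivlMr// => h.
    have := mulr_ge0 (t0 m) (ltW p0).
    move: h; move: (1 + p y) (3^-1 ^+ N) (3^-1 ^+ m) => a b c h h'.
    rewrite (_ : _ * a = 3 / 2 * (b * a) - 3 / 2 * (c * a)); last by field.
    by move: h h'; move: (b * a) (c * a); goal_lra.
  exists N => m n Nm Nn; rewrite -(subrK (F N y) (F m y)) -addrA.
  apply: le_lt_trans (modulusD _ _ _) _; rewrite [ltRHS]splitr ltrD ?FN//.
  by rewrite modulus_distC FN.
have /choice [g hg] := Flim.
have gF y n (c : R) : (forall m, (n <= m)%N -> mod (F m y) <= c) -> mod (g y) <= c.
  move=> h; apply/ler_addgt0Pl => e /(hg y) [N hN].
  have := hN _ (leq_maxr n N); rewrite modulus_distC => /ltW.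
  have := h _ (leq_maxl n N); have := modulusD S (F (maxn n N) y) (g y - F (maxn n N) y).
  rewrite addrC subrK; move: (mod _) (mod _) (mod _); goal_lra.
have Fg y n (c : R) : (forall m, (n <= m)%N -> c <= mod (F m y)) -> c <= mod (g y).
  move=> h; apply/ler_addgt0Pl => e /(hg y) [N hN].
  have := hN _ (leq_maxr n N) => /ltW.
  have := h _ (leq_maxl n N); have := modulusD S (g y) (F (maxn n N) y - g y).
  rewrite addrC subrK; move: (mod _) (mod _) (mod _); goal_lra.
have glin : linear (g : V -> K^o).
  move=> a y z; apply/eqP; rewrite -subr_eq0; apply/eqP/(@modulus_small _ _ S) => e e0.
  have e40 : 0 < e / 4 by rewrite divr_gt0.
  have a0 : 0 < 1 + mod a by rewrite ltr_pwDl// modulus_ge0.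
  have [N1 h1] := hg (a *: y + z) _ e40.
  have [N2 h2] := hg y (e / 4 / (1 + mod a)) (divr_gt0 e40 a0).
  have [N3 h3] := hg z _ e40.
  pose N := maxn N1 (maxn N2 N3).
  have := h1 N (leq_maxl _ _); rewrite modulus_distC => {}h1.
  have := h2 N (leq_trans (leq_maxl _ _) (leq_maxr _ _)) => {}h2.
  have := h3 N (leq_trans (leq_maxr _ _) (leq_maxr _ _)) => {}h3.
  rewrite (_ : _ - _ = (g (a *: y + z) - F N (a *: y + z)) +
    (a * (F N y - g y) + (F N z - g z))); last first.
    rewrite Flin /GRing.scale /=.
    by move: (g (_ + _)) (g y) (g z) (F N y) (F N z) => u v w' u' v'; ring.
  apply: le_lt_trans (modulusD _ _ _) _.
  apply: le_lt_trans (lerD (lexx _) (modulusD _ _ _)) _; rewrite modulusM.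
  have : mod a * mod (F N y - g y) <= e / 4.
    rewrite ltr_pdivlMr// in h2; apply: le_trans (ltW h2).
    by rewrite mulrC ler_wpM2l ?modulus_ge0// lerDr.
  by move: h1 h3 e0; move: (mod _) (mod (F N z - _)) (mod a * _); goal_lra.
have [|M hM] := Cbnd (linear_pack glin).
  exists (3 / 2) => y; rewrite linear_packE; apply: (gF y 0%N) => m _.
  have dfp k : mod (f k y) <= p y by have [fp _ _ _] := hw k; exact: fp.
  have := Fdist _ _ _ _ (leq0n m) dfp; rewrite /= subr0 => /le_trans; apply.
  rewrite expr0 mulrBr mulrBl mulr1 gerBl.
  by apply: mulr_ge0; [exact: mulr_ge0|exact: seminorm_ge0 sp].
pose n := (Num.truncn (4 * M)).+1.
have [_ Cx big dmx] := hw n.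
have := hM _ Cx; rewrite linear_packE; apply/negP; rewrite -ltNge.
apply: (@lt_le_trans _ _ (n%:R / 4)).
  have := Num.Theory.truncnS_gt (4 * M); rewrite -/n => h.
  by rewrite ltr_pdivlMr// mulrC.
apply: (Fg _ n.+1) => m nm.
have [_ [_ _ low]] := FS n.
have := Fdist _ (x n) n.+1 m nm (fun k => dmx (f k) (let: And4 h _ _ _ := hw k in h)).
rewrite -/(f n) -/(x n) => up.
have := modulusB_ge S (F n.+1 (x n)) (F n.+1 (x n) - F m (x n)).
rewrite subKr (modulus_distC S (F n.+1 _)).
have bign : n%:R <= 3^-1 ^+ n * mod (f n (x n)).
  by rewrite exprVn mulrC ler_pdivlMr ?exprn_gt0// ltW.
have := mulr_ge0 (t0 m) (modulus_ge0 S (f n (x n))).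
move: up low bign; rewrite exprS.
move: (mod (F m _ - _)) (mod (F n.+1 _)) (mod (f n _)) (3^-1 ^+ n) (3^-1 ^+ m) n%:R.
move=> a b c d e k; move: (mod _) => z.
have -> : 3 / 2 * (3^-1 * d - e) * (3 / 2 * c) = 3 / 4 * (d * c) - 9 / 4 * (e * c).
  by field.
by move: (d * c) (e * c); goal_lra.
Qed.

End UniformBoundedness.

(** * Biorthogonal families of functionals and vectors *)

Section Biorthogonal.
Context (K : numFieldType) (V : lmodType K).
Local Notation functional := {linear V -> K^o}.
Local Notation T := (functional * V)%type.
Implicit Types (s : seq T) (f g h : functional) (P : functional -> Prop).

(** Default value for lists of pairs (functional, vector). *)
Definition null_pair : T := ((\0 : functional), 0).
Local Notation x0 := null_pair.

(** Lists of pairs [(phi i, e i)] with [phi i (e j)] the Kronecker symbol. *)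
Definition biorthogonal s := forall i j, (i < size s)%N -> (j < size s)%N ->
  (nth x0 s i).1 (nth x0 s j).2 = (i == j)%:R.

Definition biorthogonal_seq (u : nat -> T) :=
  forall i j, (u i).1 (u j).2 = (i == j)%:R.

(** [f] is a linear combination of the functionals in [s]. *)
Definition spanned s f := exists c : nat -> K,
  forall x, f x = \sum_(i < size s) c i * (nth x0 s i).1 x.

Definition functionals_in P s := forall i, (i < size s)%N -> P (nth x0 s i).1.

(** Sets of functionals closed under linear combinations; the pointwise form of
    the hypothesis spares the construction of the combination. *)
Definition functional_subspace P := forall f g c h,
  P f -> P g -> (forall x, h x = f x + c * g x) -> P h.

Lemma subspace_sub_sum P s f (c : nat -> K) : functional_subspace P -> P f ->
  functionals_in P s ->
  exists2 h, P h & forall x, h x = f x - \sum_(i < size s) c i * (nth x0 s i).1 x.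
Proof.
move=> subP Pf Ps; suff H k : (k <= size s)%N -> exists2 h, P h &
    forall x, h x = f x - \sum_(i < k) c i * (nth x0 s i).1 x by exact: H.
elim: k => [_|k IH ks].
  by exists f => // x; rewrite big_ord0 subr0.
have [h Ph hE] := IH (ltnW ks).
pose g := (nth x0 s k).1.
have lh : linear ((fun x => h x - c k * g x) : V -> K^o).
  move=> a x y; rewrite !linearP /GRing.scale /=.
  by move: (h x) (h y) (g x) (g y) (c k) => ? ? ? ? ?; ring.
exists (linear_pack lh) => [|x].
  apply: (subP h g (- c k)) => //; first exact: Ps.
  by move=> x; rewrite linear_packE mulNr.
by rewrite linear_packE big_ord_recr /= opprD addrA hE.
Qed.

(** A functional outside the span of a biorthogonal family extends it, after
    subtraction of its coordinates along the family. *)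
Lemma biorthogonal_extend P s f : functional_subspace P -> functionals_in P s ->
  biorthogonal s -> P f -> ~ spanned s f ->
  exists t : T, functionals_in P (rcons s t) /\ biorthogonal (rcons s t).
Proof.
move=> subP Ps bs Pf nsf.
pose phi i := (nth x0 s i).1; pose e i := (nth x0 s i).2.
have [h Ph hE] := subspace_sub_sum (fun i => f (e i)) subP Pf Ps.
have phiE i (c : nat -> K) : (i < size s)%N ->
    phi i (\sum_(j < size s) c j *: e j) = c i.
  move=> ils; rewrite linear_sum (bigD1 (Ordinal ils)) //= linearZ /= bs// eqxx.
  rewrite big1 ?addr0 => [|j ji]; first by rewrite /GRing.scale /= mulr1.
  rewrite linearZ /= bs// (_ : (i == j) = false) ?scaler0//.
  by apply: contra_neqF ji => /eqP ij; apply/val_inj.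
have he j : (j < size s)%N -> h (e j) = 0.
  move=> js; rewrite hE (bigD1 (Ordinal js)) //= bs// eqxx mulr1 big1 ?addr0 ?subrr//.
  move=> i ij; rewrite bs// (_ : (val i == j) = false) ?mulr0//.
  by apply: contra_neqF ij => /eqP ij; apply/val_inj.
have [x hx] : exists x, h x <> 0.
  apply: contrapT => hN; apply: nsf; exists (fun i => f (e i)) => x.
  apply/eqP; rewrite -subr_eq0 -hE; apply/eqP; apply: contrapT => hx.
  by apply: hN; exists x.
pose y := (h x)^-1 *: (x - \sum_(j < size s) phi j x *: e j).
have hy : h y = 1.
  rewrite linearZ linearB linear_sum /= big1 => [|j _].
    by rewrite subr0 /GRing.scale /= mulVf//; apply/eqP.
  by rewrite linearZ /= he// scaler0.
have phiy i : (i < size s)%N -> phi i y = 0.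
  by move=> ils; rewrite linearZ linearB /= (phiE i (phi^~ x))// subrr scaler0.
exists (h, y); split=> [i|i j]; rewrite size_rcons !ltnS.
  rewrite nth_rcons leq_eqVlt => /orP[/eqP->|ils]; first by rewrite ltnn eqxx.
  by rewrite ils; exact: Ps.
rewrite !nth_rcons; case: (ltngtP i (size s)) => // [ils _|-> _].
  case: (ltngtP j (size s)) => // [js _|-> _]; first exact: bs.
  by rewrite phiy// ltn_eqF.
case: (ltngtP j (size s)) => // js _.
by rewrite he// gtn_eqF.
Qed.

(** Lists each of which is a prefix of the next are prefixes of one sequence. *)
Lemma limit_of_prefixes (A : Type) (a0 : A) (L : nat -> seq A) :
  (forall n, exists t, L n.+1 = L n ++ t) ->
  exists u : nat -> A, forall n i, (i < size (L n))%N -> nth a0 (L n) i = u i.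
Proof.
move=> pL; have pLD n k : exists t, L (n + k)%N = L n ++ t.
  elim: k => [|k [t IH]]; first by exists [::]; rewrite addn0 cats0.
  by have [t' Lt'] := pL (n + k)%N; exists (t ++ t'); rewrite addnS Lt' IH catA.
have coh n m i : (i < size (L n))%N -> (i < size (L m))%N ->
    nth a0 (L n) i = nth a0 (L m) i.
  wlog nm : n m / (n <= m)%N => [h|] iln ilm.
    by have [/h|/ltnW/h h'] := leqP n m; [exact|rewrite h'].
  have := pLD n (m - n)%N; rewrite subnKC// => -[t ->].
  by rewrite nth_cat iln.
have /choice [u hu] : forall i, exists a,
    forall n, (i < size (L n))%N -> nth a0 (L n) i = a.
  move=> i; have [[n iln]|ni] := pselect (exists n, (i < size (L n))%N).
    by exists (nth a0 (L n) i) => m ilm; exact: coh.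
  by exists a0 => n iln; case: ni; exists n.
by exists u => n i; exact: hu.
Qed.

(** Without an infinite biorthogonal sequence in [P], every biorthogonal list
    in [P] extends to one that spans [P]. *)
Lemma biorthogonal_maximal P s : functional_subspace P -> functionals_in P s ->
  biorthogonal s ->
  ~ (exists u, biorthogonal_seq u /\ forall i, P (u i).1) ->
  exists t, [/\ functionals_in P (s ++ t), biorthogonal (s ++ t) &
    forall f, P f -> spanned (s ++ t) f].
Proof.
move=> subP Ps bs ninf; apply: contrapT => nmax; apply: ninf.
have /choice [step hstep] : forall s', exists t : T,
    [/\ (exists t, s' = s ++ t), functionals_in P s' & biorthogonal s'] ->
    functionals_in P (rcons s' t) /\ biorthogonal (rcons s' t).
  move=> s'; have [[[t ->] Ps' bs']|ns'] := pselect
      [/\ (exists t, s' = s ++ t), functionals_in P s' & biorthogonal s'];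
    last by exists x0.
  have [f Pf nf] : exists2 f, P f & ~ spanned (s ++ t) f.
    apply: contrapT => h; apply: nmax; exists t; split=> // f Pf.
    by apply: contrapT => nf; apply: h; exists f.
  by have [t' ht'] := biorthogonal_extend subP Ps' bs' Pf nf; exists t'.
pose L n := iter n (fun s' => rcons s' (step s')) s.
have LP n : [/\ (exists t, L n = s ++ t), functionals_in P (L n) & biorthogonal (L n)].
  elim: n => [|n IH]; first by split=> //; exists [::]; rewrite cats0.
  have [Pn bn] := hstep _ IH; split=> //.
  by case: IH => -[t Lt] _ _; exists (rcons t (step (L n))); rewrite -rcons_cat -Lt.
have sL n : size (L n) = (size s + n)%N.
  by elim: n => [|n IH]; rewrite ?addn0//= size_rcons IH addnS.
have pL n : exists t, L n.+1 = L n ++ t by exists [:: step (L n)]; rewrite cats1.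
have [u uE] := limit_of_prefixes x0 pL.
have lt_size i n : (i < n)%N -> (i < size (L n))%N.
  by move=> h; rewrite sL (leq_trans h)// leq_addl.
exists u; split=> [i j|i].
  have [iN jN] : (i < (maxn i j).+1)%N /\ (j < (maxn i j).+1)%N.
    by rewrite !ltnS leq_maxl leq_maxr.
  rewrite -(uE _ _ (lt_size _ _ iN)) -(uE _ _ (lt_size _ _ jN)).
  by have [_ _] := LP (maxn i j).+1; apply; exact: lt_size.
rewrite -(uE _ _ (lt_size _ _ (ltnSn i))).
by have [_ + _] := LP i.+1; apply; exact: lt_size.
Qed.

(** [m] functionals have a nontrivial common zero among the combinations of
    [m + 1] vectors. *)
Lemma common_kernel m (fs : 'I_m -> functional) (e : nat -> V) :
  exists2 c : nat -> K, exists2 i, (i < m.+1)%N & c i <> 0 &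
    forall j, fs j (\sum_(i < m.+1) c i *: e i) = 0.
Proof.
pose A : 'M[K]_(m.+1, m) := \matrix_(i, j) fs j (e i).
have : kermx A != 0.
  rewrite -mxrank_eq0 mxrank_ker -lt0n subn_gt0 ltnS; exact: rank_leq_col.
case/rowV0Pn => v /sub_kermxP vA v0.
have [i vi] : exists i, v 0 i != 0.
  apply/existsP; apply: contraNT v0 => /existsPn vi; apply/eqP/rowP => i.
  by rewrite mxE; apply/eqP; have := vi i; rewrite negbK.
exists (fun k => v 0 (inord k)).
  by exists (i : nat) => //; rewrite inord_val; apply/eqP.
move=> j; have /rowP/(_ j) := vA; rewrite !mxE => vAj.
rewrite linear_sum /= -[RHS]vAj; apply: eq_bigr => k _.
by rewrite linearZ /= inord_val mxE.
Qed.

(** Among [m + 1] functionals of a biorthogonal family, one does not vanish on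
    the common kernel of [m] given functionals. *)
Lemma biorthogonal_kernel m (fs : 'I_m -> functional) (u : nat -> T) :
  (forall i j, (i < m.+1)%N -> (j < m.+1)%N -> (u i).1 (u j).2 = (i == j)%:R) ->
  exists2 x, forall j, fs j x = 0 & exists2 i, (i < m.+1)%N & (u i).1 x <> 0.
Proof.
move=> bu; have [c [i im ci] cfs] := common_kernel fs (fun i => (u i).2).
exists (\sum_(i < m.+1) c i *: (u i).2) => //; exists i => //.
rewrite linear_sum (bigD1 (Ordinal im)) //= linearZ /= bu// eqxx.
rewrite big1 ?addr0 => [|j ji]; first by rewrite /GRing.scale /= mulr1.
rewrite linearZ /= bu// (_ : (i == j) = false) ?scaler0//.
by apply: contra_neqF ji => /eqP ij; apply/val_inj.
Qed.

End Biorthogonal.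

(** * Ascoli spaces from countable bases of continuous functions *)

Section CompactOpen.
Context (R : realType) (Z : topologicalType).
Implicit Types (f g : Ck R Z).
Local Notation fn := (fun h : Ck R Z => (h : continuousType Z R) : Z -> R).

Lemma Ck_nbhs g (C : set Z) (O : set R) : compact C -> open O ->
  fn g @` C `<=` O -> nbhs g [set h : Ck R Z | fn h @` C `<=` O].
Proof.
move=> cC oO gCO.
have [B [[D oD <-] Dg BD]] : nbhs (fn g : {compact-open, Z -> R}) [set h | h @` C `<=` O].
  by apply: open_nbhs_nbhs; split => //; exact: compact_open_open.
exists (fn @^-1` (\bigcup_(i in D) i)); split => //.
  by exists (\bigcup_(i in D) i) => //; exists D.
by move=> h /= /BD.
Qed.

Lemma Ck_cvg (F : set_system (Ck R Z)) g : Filter F ->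
  (forall (C : set Z) (O : set R), compact C -> open O -> fn g @` C `<=` O ->
    F [set h | fn h @` C `<=` O]) -> F --> g.
Proof.
move=> FF h A [_ [[B oB <-] Bg BA]].
have H : fn @ F --> (fn g : {compact-open, Z -> R}) by apply/compact_open_cvgP.
have := H B (open_nbhs_nbhs (conj oB Bg)).
exact: (@filterS _ F FF _ _ (fun k => BA k)).

Qed.

End CompactOpen.

(** The terms of a convergent sequence form, with its limit, a compact set. *)
Lemma compact_cvg_range (T : topologicalType) (u : nat -> T) (l : T) :
  (forall U, nbhs l U -> exists N, forall n, (N <= n)%N -> U (u n)) ->
  compact (l |` range u).
Proof.
move=> ul F FF FA.
have [cl|ncl] := pselect (cluster F l); first by exists l; split => //; left.
have [U Ul [B FB UB]] : exists2 U, nbhs l U & exists2 B, F B & U `&` B = set0.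
  apply: contrapT => h; apply: ncl => B U FB Ul.
  apply/set0P/eqP => BU; apply: h; exists U => //; exists B => //.
  by rewrite setIC.
have [N hN] := ul _ Ul.
have cf : compact (u @` `I_N) by apply: finite_compact; exact: finite_image.
have Ff : F (u @` `I_N).
  apply: filterS (filterI FA FB) => x [[->|[n _ <-]]] Bx.
    by exfalso; rewrite -[False]/(set0 l) -UB; split => //; exact: nbhs_singleton.
  exists n => //=; rewrite ltnNge; apply/negP => /hN Ux.
  by rewrite -[False]/(set0 (u n)) -UB.
have [x [[n _ <-] cx]] := cf F FF Ff.
by exists (u n); split => //; right; exists n.
Qed.

Section AscoliCriterion.
Context (R : realType) (Z : topologicalType).

(** At [z], the sets where [psi n < 1] form a decreasing base of neighborhoods
    cut out by continuous functions. *)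
Definition functional_base (z : Z) (psi : nat -> Z -> R) :=
  [/\ forall n, continuous (psi n), forall n, psi n z = 0,
      forall n y, psi n y <= psi n.+1 y &
      forall U, nbhs z U -> exists n, forall y, psi n y < 1 -> U y].

Context (base : forall z, exists psi, functional_base z psi).

Lemma functional_base_completely_regular : completely_regular_space Z.
Proof.
move=> a B clB nBa; apply/(@uniform_separatorP Z R).
have [psi [psic psia _ psiU]] := base a.
have [n hn] : exists n, forall y, psi n y < 1 -> ~ B y.
  by apply: psiU; apply: open_nbhs_nbhs; split => //; rewrite openC.
exists (fun y => 1 - Num.max (1 - `|psi n y|) 0); split.
- move=> y; apply: cvgB; first exact: cvg_cst.
  apply: (@continuous_max R Z (fun y => 1 - `|psi n y|) (fun=> 0)).
    by apply: cvgB; [exact: cvg_cst|apply: cvg_norm; exact: psic].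
  exact: cvg_cst.
- move=> _ [y _ <-]; rewrite /= in_itv /= subr_ge0 ge_max ler01 andbT gerBl normr_ge0 /=.
  by rewrite gerBl le_max lexx orbT.
- by move=> _ [_ -> <-]; rewrite psia normr0 subr0 (max_l ler01) subrr.
- move=> _ [y By <-] /=; rewrite max_r ?subr0// subr_le0.
  apply: le_trans (ler_norm _); rewrite leNgt; apply/negP => /hn; exact.
Qed.

Lemma functional_base_ascoli : hausdorff_space Z -> ascoli_space R Z.
Proof.
move=> hZ; split; first by split => //; exact: functional_base_completely_regular.
move=> A cA; apply/subspace_continuousP => -[z f] [_ /= Af].
have [psi [psic psiz psimon psiU]] := base z.
have psile n m y : (n <= m)%N -> psi n y <= psi m y.
  elim: m => [|m IH]; first by rewrite leqn0 => /eqP->.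
  rewrite leq_eqVlt => /orP[/eqP->//|/IH h]; exact: le_trans h (psimon _ _).
have psi_nbhs n : nbhs z [set y | psi n y < 1].
  have /cvgrPdist_lt/(_ 1 ltr01) := psic n z; rewrite psiz.
  by apply: filterS => y; rewrite sub0r normrN => /(le_lt_trans (ler_norm _)).
(* Otherwise some [(y n, g n)] with [psi n (y n) < 1], [g n] in [A] and [g n z]
   close to [f z] have [g n (y n)] far from [f z]. *)
apply/cvgrPdist_lt => e e0 /=; apply: contrapT => nnear.
have e20 : 0 < e / 2 by rewrite divr_gt0.
have fnear : nbhs f [set g : Ck R Z |
    `|(g : continuousType Z R) z - (f : continuousType Z R) z| < e / 2].
  have := @Ck_nbhs R Z f [set z] (ball ((f : continuousType Z R) z) (e / 2))
    (@compact_set1 _ z) (ball_open _ _).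
  have fz : (fun h : Ck R Z => (h : continuousType Z R) : Z -> R) f @` [set z] `<=`
      ball ((f : continuousType Z R) z) (e / 2).
    by move=> _ [_ -> <-]; exact: ballxx.
  move=> /(_ fz); apply: filterS => g gz.
  have : ball ((f : continuousType Z R) z) (e / 2) ((g : continuousType Z R) z).
    by apply: gz; exists z.
  by rewrite -ball_normE /= distrC.
have /choice [w hw] : forall n, exists yg : Z * Ck R Z,
    [/\ psi n yg.1 < 1, A yg.2,
        `|(yg.2 : continuousType Z R) z - (f : continuousType Z R) z| < e / 2 &
        e <= `|(f : continuousType Z R) z - (yg.2 : continuousType Z R) yg.1|].
  move=> n; apply: contrapT => h; apply: nnear.
  exists ([set y | psi n y < 1], [set g : Ck R Z |
      `|(g : continuousType Z R) z - (f : continuousType Z R) z| < e / 2]).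
    by split; [exact: psi_nbhs|exact: fnear].
  move=> [y g] [/= yn gz] [_ Ag]; rewrite ltNge; apply/negP => eg.
  by apply: h; exists (y, g).
have FA : ((fun n => (w n).2) @ \oo) A by exists 0%N => // n _; have [] := hw n.
have [g [Ag gcl]] := cA _ (fmap_proper_filter _ _) FA.
have e40 : 0 < e / 4 by rewrite divr_gt0.
pose gf : Z -> R := (g : continuousType Z R).
have [M hM] : exists M, forall y, psi M y < 1 -> ball (gf z) (e / 4) (gf y).
  apply: psiU; have gc : continuous gf by exact: (@cts_fun _ _ (g : continuousType Z R)).
  by apply: gc; exact: nbhsx_ballx.
(* [g] is nearly constant on [C], hence so is [g n] for some [n >= M]. *)
pose C := z |` range (fun n => (w (n + M)%N).1).
have cC : compact C.
  apply: compact_cvg_range => U /psiU[n hn]; exists n => k nk; apply: hn.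
  have [h _ _ _] := hw (k + M)%N; apply: le_lt_trans h.
  by apply: psile; rewrite (leq_trans nk)// leq_addr.
have gC : gf @` C `<=` ball (gf z) (e / 4).
  move=> _ [y Cy <-]; apply: hM; case: Cy => [->|[n _ <-]]; first by rewrite psiz ltr01.
  have [h _ _ _] := hw (n + M)%N; apply: le_lt_trans h.
  by apply: psile; rewrite leq_addl.
have := gcl [set (w n).2 | n in [set n | (M <= n)%N]] _ _ (Ck_nbhs cC (ball_open _ _) gC).
case.
  by exists M => // n Mn; exists n.
move=> _ [[n /= Mn <-] gnC].
have [_ _ gnz gny] := hw n.
have Cz : C z by left.
have Cy : C (w n).1 by right; exists (n - M)%N => //; rewrite subnK.
have := gnC _ (ex_intro2 _ _ z Cz erefl).
have := gnC _ (ex_intro2 _ _ _ Cy erefl).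
rewrite -!ball_normE /=.
move: ((w n).2 : continuousType Z R) gnz gny => h.
move: (h z) (h (w n).1) ((f : continuousType Z R) z) => a b c gnz gny gb ga.
have := ler_distD a c b; have := ler_distD (gf z) a b.
rewrite (distrC a (gf z)) (distrC c a); move: gny gnz gb ga.
by move: `|c - b| `|a - c| `|gf z - b| `|gf z - a| `|a - b|; goal_lra.
Qed.

End AscoliCriterion.

(** * Topologies defined by scalar-valued functions *)

Section ScalarTopology.
Context (R : realType) (K : numFieldType) (S : real_scalars R K).
Local Notation mod := (modulus S).

Lemma modulus_norm (a : K^o) : mod `|a| = mod a.
Proof. by apply: (@of_real_inj _ _ S); rewrite !of_modulus normr_id. Qed.

Lemma modulus_norm_lt (X : normedZmodType K) (x : X) (e : K) : 0 < e ->
  (`|x| < e) = (mod `|x| < mod e).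
Proof.
by move=> e0; rewrite -(of_real_lt S) !of_modulus normr_id (gtr0_norm e0).
Qed.

Lemma nbhs_modulusP (X : pseudoMetricNormedZmodType K) (a : X) (U : set X) :
  nbhs a U <-> exists2 e : R, 0 < e & forall b, mod `|b - a| < e -> U b.
Proof.
rewrite nbhs_ballP; split=> [[e /= e0 eU]|[e e0 eU]].
  exists (mod e); first by have [] := pos_of_real S e0.
  move=> b be; apply: eU; rewrite -ball_normE /= modulus_norm_lt//.
  by rewrite distrC.
have e0' : 0 < of_real S e by rewrite -(rmorph0 S) of_real_lt.
exists (of_real S e) => //= b; rewrite -ball_normE /= modulus_norm_lt//.
by rewrite modulus_of_real gtr0_norm// distrC; exact: eU.
Qed.

Lemma modulus_norm_seminorm (V : lmodType K) (X : normedModType K)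
  (f : {linear V -> X}) : seminorm S (fun x => mod `|f x|).
Proof.
split=> [x y|a x].
  rewrite linearD -(of_real_le S) rmorphD !of_modulus !normr_id; exact: ler_normD.
by rewrite linearZ /= normrZ modulusM modulus_norm.
Qed.

Lemma continuous_modulus_dist (Z : topologicalType) (f : Z -> K^o) (a : K) :
  continuous f -> continuous (fun z => mod (f z - a)).
Proof.
move=> cf z; apply/cvgrPdist_lt => e e0 /=.
have : nbhs (f z) [set b | mod (b - f z) < e].
  by apply/nbhs_modulusP; exists e => // b; rewrite modulus_norm.
move=> /cf fnear.
have {}fnear : nbhs z [set y | mod (f y - f z) < e] by exact: fnear.
apply: filterS fnear => y /= fy; apply: le_lt_trans fy.
rewrite ler_distl; have := modulusD S (f y - f z) (f z - a).
rewrite addrA subrK => h; have := modulusD S (f z - f y) (f y - a).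
rewrite addrA subrK (modulus_distC S (f z) (f y)) => h'; rewrite lerBlDr.
move: h h'; move: (mod (f z - a)) (mod (f y - a)) (mod _).
by clear => u v w h h'; apply/andP; split; lra.
Qed.

(** A functional dominated by the norm of a continuous linear map into a
    normed space is continuous. *)
Lemma dominated_continuous (E : preTopologicalLmodType K) (X : normedModType K)
  (f : {linear E -> X}) (g : {linear E -> K^o}) (c : R) : continuous f ->
  dominated S (fun x => c * mod `|f x|) g -> continuous g.
Proof.
move=> cf gc z B /(nbhs_modulusP (X := K^o))[e e0 eB].
have c0 : 0 < 1 + `|c| by rewrite ltr_pwDl.
have : nbhs (f z) [set y | mod `|y - f z| < e / (1 + `|c|)].
  by apply/nbhs_modulusP; exists (e / (1 + `|c|)); rewrite ?divr_gt0.
move=> /cf fnear.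
have {}fnear : nbhs z [set y | mod `|f y - f z| < e / (1 + `|c|)] by exact: fnear.
apply: filterS fnear => y /= fy; apply: eB; rewrite modulus_norm.
rewrite -linearB; apply: le_lt_trans (gc _) _; rewrite linearB.
move: fy; rewrite ltr_pdivlMr// => /(le_lt_trans _); apply.
rewrite mulrC ler_wpM2l ?modulus_ge0//; apply: le_trans (ler_norm _) _.
by rewrite lerDr.
Qed.

(** Neighborhoods for the coarsest topology making a family of scalar-valued
    functions continuous. *)
Lemma sup_initial_nbhs (X : choiceType) (I : Type) (f : I -> X -> K^o) (z : X)
    (U : set X) :
  nbhs (z : sup_topology (fun i => Topological.class (initial_topology (f i)))) U ->
  exists m (i : 'I_m -> I) (e : R), 0 < e /\
    forall y, (forall j, mod (f (i j) y - f (i j) z) < e) -> U y.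
Proof.
(* The sets described by the conclusion form a filter that converges to [z]. *)
pose F : set_system X := [set U | exists m (i : 'I_m -> I) (e : R), 0 < e /\
    forall y, (forall j, mod (f (i j) y - f (i j) z) < e) -> U y].
have FF : Filter F.
  split.
  - exists 0%N; exists (fun j : 'I_0 => False_rect I (let: Ordinal _ h := j in notF h)).
    by exists 1; split.
  - move=> A B [m [i [e [e0 hA]]]] [m' [i' [e' [e'0 hB]]]].
    exists (m + m')%N, (fun j =>
      match fintype.split j with inl k => i k | inr k => i' k end).
    exists (Num.min e e'); split; first by rewrite lt_min e0.
    move=> y hy; split.
      apply: hA => j; have := hy (lshift m' j).
      by rewrite (unsplitK (inl j)) lt_min => /andP[].
    apply: hB => j; have := hy (rshift m j).
    by rewrite (unsplitK (inr j)) lt_min => /andP[].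
  - by move=> A B AB [m [i [e [e0 hA]]]]; exists m, i, e; split=> // y /hA /AB.
suff : F --> (z : sup_topology (fun i => Topological.class (initial_topology (f i)))).
  by move=> h /h.
apply/cvg_sup => i A [_ [[B oB <-] Bz BA]].
have /nbhs_modulusP[e e0 eB] : nbhs (f i z) B by exact: open_nbhs_nbhs.
exists 1%N, (fun=> i), e; split=> // y hy; apply: BA; apply: eB.
by rewrite modulus_norm; exact: (hy ord0).
Qed.

Lemma weak_nbhs (E : tvsType K) (z : weak E) (U : set (weak E)) : nbhs z U ->
  exists m (g : 'I_m -> dual E) (e : R), 0 < e /\
    forall y : E, (forall j, mod (sval (g j) y - sval (g j) z) < e) -> U y.
Proof. exact: sup_initial_nbhs. Qed.

Lemma weak_continuous (E : tvsType K) (g : dual E) :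
  continuous (sval g : weak E -> K^o).
Proof.
move=> z; have /cvg_sup/(_ g) h : nbhs z --> (z : weak E) by exact: cvg_id.
apply: cvg_comp h _; exact: initial_continuous.
Qed.

Lemma weak_coarser (E : tvsType K) (z : E) (U : set E) :
  @nbhs (weak E) (weak E) z U -> nbhs z U.
Proof.
move=> /weak_nbhs[m [g [e [e0 hU]]]]; apply: (filterS hU).
apply: filter_forall => j.
have : nbhs (sval (g j) z : K^o) [set b : K^o | mod (b - sval (g j) z) < e].
  by apply/nbhs_modulusP; exists e => // b; rewrite modulus_norm.
exact: (svalP (g j)).
Qed.

End ScalarTopology.

(** * Infinitely many functionals dominated by a seminorm *)

Lemma continuous_sum_ord (F : numFieldType) (V : pseudoMetricNormedZmodType F)
    (Z : topologicalType) n (f : nat -> Z -> V) :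
  (forall i, continuous (f i)) -> continuous (fun z => \sum_(i < n) f i z).
Proof.
move=> cf; elim: n => [|n IH].
  rewrite (_ : (fun z => _) = fun=> 0); last by apply/funext => z; rewrite big_ord0.
  by move=> z; exact: cvg_cst.
rewrite (_ : (fun z => _) = (fun z => \sum_(i < n) f i z + f n z)).
  by move=> z; apply: cvgD; [exact: IH|exact: cf].
by apply/funext => z; rewrite big_ord_recr.
Qed.

Lemma continuous_positive_part (R : realType) (Z : topologicalType) (f : Z -> R)
  (c : R) : continuous f -> continuous (fun z => Num.max (f z - c) 0).
Proof.
move=> cf z; apply: (@continuous_max R _ (fun z => f z - c) (fun=> 0)).
  by apply: cvgB; [exact: cf|exact: cvg_cst].
exact: cvg_cst.
Qed.

Section ContinuousPack.
Context (R : realType) (Z : topologicalType) (f : Z -> R) (cf : continuous f).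

Let continuous_pack_fun := f.
HB.instance Definition _ := @isContinuous.Build Z R continuous_pack_fun cf.

(** The point of [Ck R Z] with a given underlying function. *)
Definition continuous_pack : Ck R Z := (continuous_pack_fun : continuousType Z R).

End ContinuousPack.

Section NotAscoli.
Context (R : realType) (K : numFieldType) (S : real_scalars R K).
Context (E : tvsType K) (p : E -> R) (sp : seminorm S p).
Local Notation mod := (modulus S).
Context (pcont : forall g : {linear E -> K^o},
  (exists c, dominated S (fun x => c * p x) g) -> continuous g).

Lemma weak_compact_bounded (C : set (weak E)) : compact C ->
  exists M, forall f : {linear E -> K^o}, dominated S p f ->
    forall x, C x -> mod (f x) <= M.
Proof.
move=> cC; apply: (uniformly_bounded sp) => g gp.
pose gd : dual E := exist _ g (pcont gp).
have cg : continuous (fun x : weak E => mod (g x - 0)).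
  exact: continuous_modulus_dist (weak_continuous (g := gd)).
have /compact_bounded/ex_strict_bound_gt0[M _ hM] : compact
    ((fun x : weak E => mod (g x - 0)) @` C).
  by apply: continuous_compact => //; exact: continuous_subspaceT.
exists M => x Cx; have := hM (mod (g x - 0)).
rewrite subr0 => /(_ _)/ltW; rewrite ger0_norm ?modulus_ge0//; apply.
by exists x => //; rewrite subr0.
Qed.

(** The functions [\sum_(i <= k) max (|v i| - k, 0)] vanish on any given weakly
    compact set for large [k], but they are not small near 0 uniformly in [k]:
    a weak neighborhood of 0 contains the common kernel of finitely many
    functionals, on which those of large index are unbounded. *)
Lemma dominated_independent_not_ascoli (v : nat -> {linear E -> K^o}) :
  (forall i, dominated S p (v i)) ->
  (forall m (fs : 'I_m -> {linear E -> K^o}), exists2 x, forall j, fs j x = 0 &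
    exists2 i, (i < m.+1)%N & v i x <> 0) ->
  ~ ascoli_space R (weak E).
Proof.
move=> vp vker [_ ascE].
pose bump k (y : weak E) : R := \sum_(i < k.+1) Num.max (mod (v i y - 0) - k%:R) 0.
have bump_cont k : continuous (bump k).
  apply: (@continuous_sum_ord R R (weak E) k.+1
    (fun i y => Num.max (mod (v i y - 0) - k%:R) 0)) => i y.
  have cv : continuous (fun y : weak E => mod (v i y - 0)).
    apply: continuous_modulus_dist; apply: (weak_continuous (g := exist _ (v i) _)).
    by apply: pcont; exists 1 => x; rewrite mul1r; exact: vp.
  exact: continuous_positive_part.
pose H k : Ck R (weak E) := continuous_pack (bump_cont k).
have zero_cont : continuous ((fun=> 0) : weak E -> R).
  exact: (@cst_continuous (weak E) R 0).
pose H0 : Ck R (weak E) := continuous_pack zero_cont.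
have Hcvg : H @ \oo --> H0.
  apply: Ck_cvg => C O cC oO h0O.
  have [M hM] := weak_compact_bounded cC.
  exists (Num.truncn M).+1 => // k /= Mk _ [y Cy <-].
  have -> : bump k y = 0.
    rewrite /bump big1// => i _; rewrite max_r// subr0 subr_le0.
    apply: le_trans (hM _ (vp i) _ Cy) _; apply: le_trans (ltW (Num.Theory.truncnS_gt M)) _.
    by rewrite ler_nat.
  by apply: h0O; exists y.
have Hev (U : set (Ck R (weak E))) : nbhs H0 U -> exists N, forall n, (N <= n)%N -> U (H n).
  by move=> /Hcvg[N _ hN]; exists N => n; exact: hN.
have := ascE _ (compact_cvg_range Hev).
move=> /subspace_continuousP/(_ ((0 : E) : weak E, H0)) /(_ _)/cvgrPdist_lt.
move=> /(_ _ 1 ltr01) [].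
  by split => //; left.
move=> [V U] [/= V0 UH0] VU.
have [m [g [e [e0 gV]]]] := weak_nbhs S V0.
have [N hN] := Hev _ UH0.
pose k := maxn N m.
have [x gx [i im vx]] := vker m (fun j => sval (g j)).
have vx0 : 0 < mod (v i x).
  by rewrite lt_def modulus_ge0 modulus_eq0 andbT; apply/eqP.
(* Scaled so that the i-th term of [bump k y] is [(k + 1) - k]. *)
pose y : E := of_real S (k.+1%:R / mod (v i x)) *: x.
have vy : mod (v i y) = k.+1%:R.
  rewrite linearZ /= modulusM modulus_of_real ger0_norm ?divr_ge0 ?modulus_ge0//.
  by rewrite divfK// gt_eqF.
have Vy : V y.
  apply: gV => j; rewrite (_ : sval (g j) y = 0) ?(linear0 (sval (g j))) ?subrr ?modulus0//.
  by rewrite /y linearZ /= gx scaler0.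
have := VU (y, H k) (conj Vy (hN k (leq_maxl _ _))).
move=> near; have bump1 : `|0 - bump k y| < 1 by apply: near; split => //; right; exists k.
have ik : (i < k.+1)%N by rewrite (leq_trans im)// ltnS leq_maxr.
have: 1 <= bump k y.
  rewrite /bump (bigD1 (Ordinal ik)) //= subr0 vy.
  rewrite -[leLHS]addr0 lerD// ?sumr_ge0// => [|j _]; last by rewrite le_max lexx orbT.
  by rewrite le_max -natrB// subSnn lexx.
apply/negP; rewrite -ltNge; apply: le_lt_trans bump1.
by rewrite sub0r normrN; exact: ler_norm.
Qed.

Lemma infinite_biorthogonal_not_ascoli (u : nat -> {linear E -> K^o} * E) :
  biorthogonal_seq u ->
  (forall i, exists c, dominated S (fun x => c * p x) (u i).1) ->
  ~ ascoli_space R (weak E).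
Proof.
move=> bu /choice[c uc].
have c0 i : 0 < 1 + `|c i| by rewrite ltr_pwDl.
(* Normalization of [(u i).1] to a functional dominated by [p]. *)
pose a i : K := of_real S (1 + `|c i|)^-1.
have la i : linear ((fun x => a i * (u i).1 x) : E -> K^o).
  move=> b x y; rewrite linearP /GRing.scale /=.
  by move: ((u i).1 x) ((u i).1 y) (a i) => ? ? ?; ring.
have a0 i : a i != 0 by rewrite fmorph_eq0 invr_eq0 gt_eqF.
apply: (@dominated_independent_not_ascoli (fun i => linear_pack (la i))) => [i x|m fs].
  rewrite linear_packE modulusM modulus_of_real ger0_norm ?invr_ge0 ?(ltW (c0 i))//.
  rewrite ler_pdivrMl//; apply: le_trans (uc i x) _.
  rewrite ler_wpM2r ?(seminorm_ge0 _ sp)//; apply: le_trans (ler_norm _) _.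
  by rewrite lerDr.
have [|x fx [i im ux]] := biorthogonal_kernel (m := m) fs (u := u).
  by move=> i j _ _; exact: bu.
exists x => //; exists i => //; rewrite linear_packE => /eqP.
by rewrite mulf_eq0 (negbTE (a0 i)) => /eqP.
Qed.

End NotAscoli.

(** * Projections of a quojection *)

Lemma continuous_to_sup_initial (Z : topologicalType) (X : choiceType) (I : Type)
    (Y : I -> topologicalType) (f : forall i, X -> Y i) (g : Z -> X) :
  (forall i, continuous (f i \o g)) ->
  continuous (g : Z -> sup_topology (fun i => Topological.class (initial_topology (f i)))).
Proof.
move=> cfg z; apply/cvg_sup => i A [_ [[B oB <-] Bz BA]].
have fB : nbhs z ((f i \o g) @^-1` B) by apply: cfg; exact: open_nbhs_nbhs.
by apply: filterS fB => y /= By; apply: BA.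
Qed.

Lemma continuous_bounded (R : realType) (K : numFieldType) (S : real_scalars R K)
    (X Y : normedModType K) (f : {linear X -> Y}) : continuous f ->
  exists c : R, forall x, modulus S `|f x| <= c * modulus S `|x|.
Proof.
move=> cf; have : nbhs (f 0) [set y | modulus S `|y| < 1].
  by apply/(nbhs_modulusP S); exists 1 => // b; rewrite linear0 subr0.
move=> /cf fnear.
have {fnear} /(nbhs_modulusP S)[d d0 fd] :
  nbhs (0 : X) [set x | modulus S `|f x| < 1] by exact: fnear.
exists (2 / d) => x.
have [->|x0] := eqVneq x 0; first by rewrite linear0 !normr0 modulus0 mulr0.
have mx0 : 0 < modulus S `|x| by rewrite lt_def modulus_ge0 modulus_eq0 normr_eq0 x0.
have sf := modulus_norm_seminorm S f.
have sid := modulus_norm_seminorm S (@idfun X : {linear X -> X}).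
pose r := d / 2 / modulus S `|x|.
have r0 : 0 < r by rewrite !divr_gt0.
have := fd (of_real S r *: x).
rewrite subr0 (sid.2 (of_real S r) x) /= (sf.2 (of_real S r) x).
rewrite modulus_of_real gtr0_norm//.
have -> : r * modulus S `|x| < d.
  by rewrite /r divfK ?gt_eqF// ltr_pdivrMr// ltr_pMr// ltr1n.
move=> /(_ isT); rewrite -ltr_pdivlMl// mulr1 => /ltW h; apply: le_trans h _.
by rewrite /r invf_div invf_div mulrC lexx.
Qed.

Section ProjectiveLimitTopology.
Context (K : numFieldType) (V : nat -> preTopologicalLmodType K).
Context (f : forall n, {linear V n.+1 -> V n}).

Lemma projlim_coord_continuous n :
  continuous (fun x : projlim f => projlim_val x n).
Proof.
move=> x; have c1 := @initial_continuous _ _ (@projlim_val K V f) x.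
have c2 := @proj_continuous nat V n (projlim_val x).
exact: (@continuous_comp (projlim f) (prod_topology V) (V n) (@projlim_val K V f)
  (@proj nat V n) x c1 c2).
Qed.

Lemma continuous_to_projlim (Z : topologicalType) (g : Z -> projlim f) :
  (forall n, continuous (fun z => projlim_val (g z) n)) -> continuous g.
Proof.
move=> cg z A [_ [[B oB <-] Bz BA]].
have cv : continuous ((fun z => projlim_val (g z)) : Z -> prod_topology V).
  exact: (@continuous_to_sup_initial Z _ nat V (fun n (x : prod_topology V) => x n)).
have gB := cv z B (open_nbhs_nbhs (conj oB Bz)).
have {}gB : nbhs z [set y | B (projlim_val (g y))] by exact: gB.
by apply: filterS gB => y /= By; apply: BA.
Qed.

End ProjectiveLimitTopology.

(** A quojection [E] seen through its projections [pi n] onto the spaces of the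
    projective system: every thread comes from [E], the projections separate
    points and induce the topology. *)
Lemma quojection_projections (K : numFieldType) (E : tvsType K) : quojection E ->
  exists (X : nat -> completeNormedModType K) (f : forall n, {linear X n.+1 -> X n})
         (pi : forall n, {linear E -> X n}),
  [/\ forall n, continuous (f n) /\ continuous (pi n),
      forall n x, f n (pi n.+1 x) = pi n x,
      forall x : forall n, X n, (forall n, f n (x n.+1) = x n) ->
        exists e, forall n, pi n e = x n,
      forall x, (forall n, pi n x = 0) -> x = 0 &
      forall (Z : topologicalType) (g : Z -> E),
        (forall n, continuous (pi n \o g)) -> continuous g].
Proof.
move=> [X [f [cf _ [g [h [gK hK cg ch]]]]]].
have lpi n : linear ((fun x => projlim_val (g x) n) : E -> X n).
  by move=> a x y; rewrite linearP.
exists X, f, (fun n => linear_pack (lpi n)); split.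
- move=> n; split; first exact: cf.
  move=> x A xA.
  exact: (cg x _ (@projlim_coord_continuous K (fun n => X n) f n (g x) A xA)).
- by move=> n x; rewrite !linear_packE; have /asboolP := projlim_valP (g x); exact.
- move=> x xf; have xP : x \in @threads K (fun n => X n) f by apply/asboolP.
  by exists (h (ProjLim xP)) => n; rewrite linear_packE hK.
- move=> x x0; have gx0 : g x = 0.
    apply: val_inj; apply: functional_extensionality_dep => n.
    by have := x0 n; rewrite linear_packE.
  by apply: (can_inj gK); rewrite gx0 linear0.
- move=> Z k ck.
  have cgk : continuous (g \o k) by exact: continuous_to_projlim.
  have kE : k = h \o (g \o k) by apply/funext => z /=; rewrite gK.
  rewrite kE => z A zA.
  exact: (cgk z _ (ch (g (k z)) A zA)).
Qed.

(** * Coordinates on a quojection with Ascoli weak topology *)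

Lemma continuous_scale_cst (K : numFieldType) (V : normedModType K)
    (Z : topologicalType) (s : Z -> K) (a : V) :
  continuous s -> continuous (fun z => s z *: a).
Proof. by move=> cs z; apply: cvgZr_tmp; exact: cs. Qed.

Lemma power_coord_continuous (K : numFieldType) i :
  continuous (fun c : countable_power K => c i : K).
Proof. exact: (@proj_continuous nat (fun=> K^o) i). Qed.

Section Dominated.
Context (R : realType) (K : numFieldType) (S : real_scalars R K).
Context (V : lmodType K) (p : V -> R) (sp : seminorm S p).

(** The functionals that are continuous for the seminorm [p]. *)
Definition bounded_by (f : {linear V -> K^o}) :=
  exists c, dominated S (fun x => c * p x) f.

Lemma bounded_by_subspace : functional_subspace bounded_by.
Proof.
move=> f g c h [a fa] [b gb] hE; exists (a + modulus S c * b) => x.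
rewrite hE; apply: le_trans (modulusD _ _ _) _; rewrite modulusM mulrDl -mulrA.
by rewrite lerD// ler_wpM2l// modulus_ge0.
Qed.

Lemma bounded_by_eq0 (f : {linear V -> K^o}) x : bounded_by f -> p x = 0 -> f x = 0.
Proof.
move=> [c /(_ x)] + px; rewrite px mulr0 => h.
by apply/eqP; rewrite -(modulus_eq0 S) eq_le h modulus_ge0.
Qed.

(** By the Hahn-Banach theorem a family spanning the functionals bounded by
    [p] vanishes only where [p] does. *)
Lemma spanning_family_eq0 s x : (forall f, bounded_by f -> spanned s f) ->
  (forall i, (i < size s)%N -> (nth (null_pair V) s i).1 x = 0) -> p x = 0.
Proof.
move=> sspan sx; apply: contrapT => /eqP px.
have [g gp] := hahn_banach sp px; apply.
have [|c ->] := sspan g; first by exists 2.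
by rewrite big1// => i _; rewrite sx ?mulr0.
Qed.

End Dominated.

Section AscoliImplies.
Context (R : realType) (K : numFieldType) (S : real_scalars R K) (E : tvsType K).
Context (X : nat -> completeNormedModType K) (f : forall n, {linear X n.+1 -> X n}).
Context (pi : forall n, {linear E -> X n}).
Context (f_cont : forall n, continuous (f n)) (pi_cont : forall n, continuous (pi n)).
Context (pi_f : forall n x, f n (pi n.+1 x) = pi n x).
Context (pi_thread : forall x : forall n, X n, (forall n, f n (x n.+1) = x n) ->
  exists e, forall n, pi n e = x n).
Context (pi_inj : forall x, (forall n, pi n x = 0) -> x = 0).
Context (pi_joint : forall (Z : topologicalType) (g : Z -> E),
  (forall n, continuous (pi n \o g)) -> continuous g).
Context (ascE : ascoli_space R (weak E)).

Local Notation x0 := (null_pair E).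
Let p n x : R := modulus S `|pi n x|.
Local Notation D n := (bounded_by S (p n)).

Let sp n : seminorm S (p n).
Proof. exact: modulus_norm_seminorm. Qed.

Let p_eq0 n x : p n x = 0 -> pi n x = 0.
Proof. by move=> /eqP; rewrite modulus_eq0 normr_eq0 => /eqP. Qed.

Let D_cont n (g : {linear E -> K^o}) : D n g -> continuous g.
Proof. by move=> [c gc]; exact: dominated_continuous (@pi_cont n) gc. Qed.

Let D_mono n g : D n g -> D n.+1 g.
Proof.
move=> [c gc]; have [b fb] := continuous_bounded S (@f_cont n).
exists (`|c| * b) => x; apply: le_trans (gc x) _.
apply: (@le_trans _ _ (`|c| * p n x)); first by rewrite ler_wpM2r ?modulus_ge0// ler_norm.
by rewrite -mulrA ler_wpM2l// /p -pi_f.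
Qed.

Let no_infinite n : ~ exists u : nat -> {linear E -> K^o} * E,
  biorthogonal_seq u /\ forall i, D n (u i).1.
Proof.
move=> [u [bu uD]].
exact: (infinite_biorthogonal_not_ascoli (sp n) (@D_cont n) bu uD ascE).
Qed.

(** The functionals bounded by a multiple of [p n] are spanned by the first [d n]
    functionals of a sequence that is biorthogonal, with suitable vectors, on
    these segments. *)
Lemma exists_spanning_tower : exists (u : nat -> {linear E -> K^o} * E) (d : nat -> nat),
  [/\ forall n, (d n <= d n.+1)%N,
      forall n i j, (i < d n)%N -> (j < d n)%N -> (u i).1 (u j).2 = (i == j)%:R,
      forall n i, (i < d n)%N -> D n (u i).1,
      forall n g, D n g -> exists c : nat -> K,
        forall x, g x = \sum_(i < d n) c i * (u i).1 x &
      forall n x, (forall i, (i < d n)%N -> (u i).1 x = 0) -> pi n x = 0].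
Proof.
pose ok n s := functionals_in (D n) s /\ biorthogonal s.
have /choice[next hnext] : forall ns : nat * seq ({linear E -> K^o} * E),
    exists t, ok ns.1 ns.2 ->
      [/\ functionals_in (D ns.1) (ns.2 ++ t), biorthogonal (ns.2 ++ t) &
      forall g, D ns.1 g -> spanned (ns.2 ++ t) g].
  move=> [n s]; have [[Ds bs]|nok] := pselect (ok n s); last by exists [::].
  have [t ht] := biorthogonal_maximal
    (bounded_by_subspace (S := S) (p := p n)) Ds bs (@no_infinite n).
  by exists t.
pose L := fix L n := let s := if n is m.+1 then L m else [::] in s ++ next (n, s).
have LP n : [/\ functionals_in (D n) (L n), biorthogonal (L n) &
    forall g, D n g -> spanned (L n) g].
  elim: n => [|n [Dn bn _]]; first by apply: (hnext (0%N, [::])); split=> i.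
  apply: (hnext (n.+1, L n)); split => // i iL; apply: D_mono; exact: Dn.
have [u uE] : exists u, forall n i, (i < size (L n))%N -> nth x0 (L n) i = u i.
  by apply: limit_of_prefixes => n; exists (next (n.+1, L n)).
exists u, (fun n => size (L n)); split.
- by move=> n; rewrite /= size_cat leq_addr.
- by move=> n i j ni nj; rewrite -(uE n)// -(uE n)//; have [_ + _] := LP n; apply.
- by move=> n i ni; rewrite -(uE n)//; have [+ _ _] := LP n; apply.
- move=> n g Dg; have [_ _ /(_ g Dg)[c gc]] := LP n; exists c => x.
  by rewrite gc; apply: eq_bigr => i _; rewrite uE.
- move=> n x ux; apply: p_eq0; have [_ _ sL] := LP n.
  by apply: (spanning_family_eq0 (sp n) sL) => i iL; rewrite uE//; exact: ux.
Qed.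

Lemma ascoli_finite_dimensional_or_power :
  finite_dimensional E \/ tvs_isomorphic E (countable_power K).
Proof.
have [u [d [dmono ub uD uspan uker]]] := exists_spanning_tower.
have dle n m : (n <= m)%N -> (d n <= d m)%N.
  elim: m => [|m IH]; first by rewrite leqn0 => /eqP->.
  by rewrite leq_eqVlt => /orP[/eqP->//|/IH h]; exact: leq_trans h (dmono m).
pose comb m (c : nat -> K) : E := \sum_(i < m) c i *: (u i).2.
have ucomb n c i : (i < d n)%N -> (u i).1 (comb (d n) c) = c i.
  move=> iN; rewrite linear_sum (bigD1 (Ordinal iN)) //= linearZ /= (ub n)// eqxx.
  rewrite big1 ?addr0 => [|j ji]; first by rewrite /GRing.scale /= mulr1.
  rewrite linearZ /= (ub n)// (_ : (i == j) = false) ?scaler0//.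
  by apply: contra_neqF ji => /eqP ij; apply/val_inj.
(* Bounded lengths give a finite power, unbounded ones the countable power. *)
have [unb|nunb] := pselect (forall i, exists n, (i < d n)%N); last first.
  left; have [i0 hi0] : exists i0, forall n, (d n <= i0)%N.
    apply: contrapT => h; apply: nunb => i; apply: contrapT => h'; apply: h.
    by exists i => n; rewrite leqNgt; apply/negP => ni; apply: h'; exists n.
  have exd : exists k, `[< exists n, d n = k >].
    by exists (d 0%N); apply/asboolP; exists 0%N.
  have [_ /asboolP[N <-] dmax] := @ex_maxnP (fun k => `[< exists n, d n = k >]) i0 exd
    (fun k => ltac:(by move=> /asboolP[n <-])).
  have {}dmax n : (d n <= d N)%N by apply: dmax; apply/asboolP; exists n.
  have lF : linear ((fun x => \row_(i < d N) (u i).1 x) : E -> 'rV[K]_(d N)).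
    by move=> a x y; apply/rowP => i; rewrite !mxE linearP.
  have Finj x : linear_pack lF x = 0 -> x = 0.
    rewrite linear_packE => /rowP Fx; apply: pi_inj => n; apply: uker => i ni.
    by have := Fx (Ordinal (leq_trans ni (dmax n))); rewrite !mxE.
  pose G (v : 'rV[K]_(d N)) : E := \sum_(i < d N) v 0 i *: (u i).2.
  have FG v : linear_pack lF (G v) = v.
    apply/rowP => i; rewrite linear_packE mxE /G linear_sum (bigD1 i) //= linearZ /=.
    rewrite (ub N)// eqxx big1 ?addr0 => [|j ji]; first by rewrite /GRing.scale /= mulr1.
    rewrite linearZ /= (ub N)// (_ : (val i == j) = false) ?scaler0//.
    by apply: contra_neqF ji => /eqP ij; apply/val_inj.
  exists (d N), (linear_pack lF); exists G => // x.
  by apply/eqP; rewrite -subr_eq0; apply/eqP/Finj; rewrite linearB FG subrr.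
right.
have lT : linear ((fun x i => (u i).1 x) : E -> countable_power K).
  by move=> a x y; apply: functional_extensionality_dep => i; rewrite linearP.
have Tinj x : (forall i, (u i).1 x = 0) -> x = 0.
  by move=> Tx; apply: pi_inj => n; apply: uker => i _; exact: Tx.
have /choice[G hG] : forall c : nat -> K, exists x, forall i, (u i).1 x = c i.
  (* The combinations of [d n] terms form a thread: the terms of index at least
     [d n] have null n-th projection. *)
  move=> c; have [n|e he] := pi_thread (x := fun n => pi n (comb (d n) c)).
    rewrite pi_f; apply/eqP; rewrite -subr_eq0 -linearB; apply/eqP/uker => i ni.
    by rewrite linearB /= !ucomb ?subrr// (leq_trans ni).
  exists e => i; have [n ni] := unb i.
  apply/eqP; rewrite -(ucomb n c i ni) -subr_eq0 -linearB; apply/eqP.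
  apply: (bounded_by_eq0 (uD n i ni)).
  by rewrite /p linearB /= he subrr normr0 modulus0.
exists (linear_pack lT), G; split.
- move=> x; apply/eqP; rewrite -subr_eq0; apply/eqP/Tinj => i.
  by rewrite linearB /= hG subrr.
- by move=> c; apply: functional_extensionality_dep => i; rewrite /= hG.
- apply: (@continuous_to_sup_initial E _ nat (fun=> K^o) (fun i (x : nat -> K^o) => x i)).
  by move=> i; have [n ni] := unb i; exact: D_cont (uD n i ni).
- apply: pi_joint => n.
  have -> : pi n \o G = (fun c : countable_power K => \sum_(i < d n) c i *: pi n (u i).2).
    apply/funext => c /=; rewrite (_ : \sum_(i < d n) _ = pi n (comb (d n) c)).
      apply/eqP; rewrite -subr_eq0 -linearB; apply/eqP/uker => i ni.
      by rewrite linearB /= hG ucomb// subrr.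
    by rewrite linear_sum; apply: eq_bigr => i _; rewrite linearZ.
  apply: (@continuous_sum_ord K (X n) (countable_power K) (d n)
    (fun i c => c i *: pi n (u i).2)) => i.
  by apply: continuous_scale_cst; exact: power_coord_continuous.
Qed.

End AscoliImplies.

(** * Weak topologies determined by countably many coordinates *)

Lemma continuous_const_mul (R : realType) (Z : topologicalType) (f : Z -> R) (c : R) :
  continuous f -> continuous (fun z => c * f z).
Proof. by move=> cf z; apply: cvgM; [exact: cvg_cst|exact: cf]. Qed.

Section AscoliFromCoordinates.
Context (R : realType) (K : numFieldType) (S : real_scalars R K) (E : tvsType K).
Local Notation mod := (modulus S).
Context (phi : nat -> {linear E -> K^o}).
Context (phi_cont : forall i, continuous (phi i)).
Context (phi_sep : forall x, (forall i, phi i x = 0) -> x = 0).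
Context (phi_nbhs : forall (z : weak E) (U : set (weak E)), nbhs z U ->
  exists n (e : R), 0 < e /\
    forall y, (forall i, (i < n)%N -> mod (phi i y - phi i z) < e) -> U y).

Let phi_weak i : continuous (phi i : weak E -> K^o).
Proof. exact: (weak_continuous (g := exist _ (phi i) (@phi_cont i))). Qed.

Let phi_near i (z : weak E) (e : R) : 0 < e ->
  nbhs z [set y | mod (phi i y - phi i z) < e].
Proof.
move=> e0; have B : nbhs (phi i z : K^o) [set b : K^o | mod (b - phi i z) < e].
  by apply/(nbhs_modulusP S); exists e => // b; rewrite modulus_norm.
exact: (@phi_weak i z _ B).
Qed.

Lemma weak_hausdorff : hausdorff_space (weak E).
Proof.
move=> x y xy; apply: contrapT => nxy.
have [i pxy] : exists i, phi i (x - y : E) <> 0.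
  apply: contrapT => h; apply: nxy; apply/eqP; rewrite -subr_eq0; apply/eqP.
  by apply: phi_sep => i; apply: contrapT => h'; apply: h; exists i.
pose e := mod (phi i (x - y : E)) / 2.
have e0 : 0 < e.
  by rewrite divr_gt0// lt_def modulus_ge0 modulus_eq0 andbT; apply/eqP.
have [w [/= wx wy]] := xy _ _ (phi_near i x e0) (phi_near i y e0).
have := modulusD S (phi i x - phi i w) (phi i w - phi i y).
rewrite addrA subrK -linearB modulus_distC; move: wx wy.
rewrite /e; move: (mod (phi i (x - y))) (mod (phi i w - phi i x)) (mod (phi i w - _)).
goal_lra.
Qed.

(** Countably many continuous functionals that separate points and determine
    the weak neighborhoods make the weak topology Ascoli. *)
Lemma coordinates_ascoli : ascoli_space R (weak E).
Proof.
apply: functional_base_ascoli weak_hausdorff => z.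
pose sum n (y : weak E) := \sum_(i < n) mod (phi i y - phi i z).
have sum0 n y : 0 <= sum n y by apply: sumr_ge0 => i _; exact: modulus_ge0.
(* The factor [n + 1] turns [psi n < 1] into the bound [1 / (n + 1)]. *)
exists (fun n y => n.+1%:R * sum n y); split.
- move=> n; apply: (@continuous_const_mul R (weak E)).
  apply: (@continuous_sum_ord R R (weak E) n (fun i y => mod (phi i y - phi i z))) => i.
  exact: continuous_modulus_dist.
- by move=> n; rewrite /sum big1 ?mulr0// => i _; rewrite subrr modulus0.
- move=> n y; rewrite ler_pM// ?ler_nat// /sum big_ord_recr /=.
  by rewrite lerDl modulus_ge0.
- move=> U /phi_nbhs[n [e [e0 hU]]]; pose m := maxn n (Num.truncn e^-1).
  exists m => y ym; apply: hU => i ni.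
  have im : (i < m)%N by rewrite (leq_trans ni)// leq_maxl.
  apply: (@le_lt_trans _ _ (sum m y)).
    rewrite /sum (bigD1 (Ordinal im)) //= lerDl.
    by apply: sumr_ge0 => j _; exact: modulus_ge0.
  move: ym; rewrite mulrC -ltr_pdivlMr// mul1r => /lt_le_trans; apply.
  rewrite -[leRHS]invrK lef_pV2 ?posrE ?invr_gt0//.
  apply: le_trans (ltW (Num.Theory.truncnS_gt _)) _.
  by rewrite ler_nat ltnS leq_maxr.
Qed.

End AscoliFromCoordinates.

Lemma power_ascoli (R : realType) (K : numFieldType) (S : real_scalars R K)
  (E : tvsType K) : tvs_isomorphic E (countable_power K) -> ascoli_space R (weak E).
Proof.
move=> [T [G [TG GT cT cG]]].
have lphi i : linear ((fun x => T x i) : E -> K^o) by move=> a x y; rewrite linearP.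
have phi_cont i : continuous (linear_pack (lphi i)).
  by move=> x A xA; exact: (cT x _ (@power_coord_continuous K i (T x) A xA)).
apply: (coordinates_ascoli (S := S) phi_cont) => [x Tx|z U zU].
  apply: (can_inj TG); rewrite linear0; apply: functional_extensionality_dep => i.
  by have := Tx i; rewrite linear_packE.
(* The weak topology is coarser than that of [E], which is the product one. *)
have EU : @nbhs E E z U by apply: (weak_coarser S).
have GU : nbhs (T z) [set c | U (G c)] by apply: (cG (T z)); rewrite TG.
have [m [i [e [e0 hU]]]] := sup_initial_nbhs S (GU : nbhs (T z : sup_topology
  (fun i : nat => Topological.class (initial_topology (fun c : nat -> K^o => c i)))) _).
exists (\max_j (i j)).+1, e; split=> // y hy; rewrite -(TG y); apply: hU => j.
by have := hy (i j); rewrite ltnS leq_bigmax => /(_ isT).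
Qed.

Section FiniteDimensional.
Context (R : realType) (K : numFieldType) (S : real_scalars R K) (E : tvsType K).
Local Notation mod := (modulus S).

Lemma continuous_functional_subspace :
  functional_subspace (fun f : {linear E -> K^o} => continuous f).
Proof.
move=> f g c h cf cg hE.
have -> : (h : E -> K^o) = (fun x => f x + c *: g x) by apply/funext => x; rewrite hE.
by move=> x; apply: cvgD; [exact: cf|apply: cvgZl_tmp; exact: cg].
Qed.

(** A finite basis of the space of continuous functionals determines the weak
    topology. *)
Lemma finite_dimensional_ascoli : finite_dimensional E ->
  (forall x : E, x <> 0 -> exists2 g : {linear E -> K^o}, continuous g & g x <> 0) ->
  ascoli_space R (weak E).
Proof.
move=> [n [F bF]] sep.
have [|||t []] := @biorthogonal_maximal K E
    (fun f : {linear E -> K^o} => continuous f) [::] continuous_functional_subspace.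
- by [].
- by [].
- move=> [u [bu _]].
  have lc j : linear ((fun x => F x 0 j) : E -> K^o).
    by move=> a x y; rewrite linearP !mxE.
  have [|x Fx [i _ ux]] :=
      biorthogonal_kernel (fun j : 'I_n => linear_pack (lc j)) (u := u).
    by move=> i j _ _; exact: bu.
  apply: ux; suff -> : x = 0 by rewrite linear0.
  apply: (bij_inj bF); rewrite linear0; apply/rowP => j; rewrite mxE.
  exact: (Fx j).
rewrite cat0s => t_cont _ tspan.
pose phi i := (nth (null_pair E) t i).1.
have phi_cont i : continuous (phi i).
  have [ti|ti] := ltnP i (size t); first exact: t_cont.
  rewrite /phi nth_default// => x; exact: cvg_cst.
apply: (coordinates_ascoli (S := S) phi_cont) => [x phix|z U zU].
  apply: contrapT => /sep[g cg]; apply.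
  have [c ->] := tspan g cg.
  by rewrite big1// => i _; rewrite (phix i) mulr0.
have [m [g [e [e0 hU]]]] := weak_nbhs S zU.
have /choice[c gc] : forall j, exists c : nat -> K,
    forall x, sval (g j) x = \sum_(i < size t) c i * phi i x.
  by move=> j; exact: tspan (svalP (g j)).
pose M j := \sum_(i < size t) mod (c j i).
have M0 j : 0 <= M j by apply: sumr_ge0 => i _; exact: modulus_ge0.
pose N := 1 + \sum_j M j.
have N0 : 0 < N by rewrite ltr_pwDl// sumr_ge0.
exists (size t), (e / N); split; first by rewrite divr_gt0.
move=> y hy; apply: hU => j.
have -> : sval (g j) y - sval (g j) z = \sum_(i < size t) c j i * (phi i y - phi i z).
  by rewrite !gc -sumrB; apply: eq_bigr => i _; rewrite mulrBr.
apply: (@le_lt_trans _ _ (M j * (e / N))).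
  rewrite /M mulr_suml; elim/big_ind2 : _ => [|a b a' b' ha hb|i _].
  - by rewrite modulus0.
  - by apply: le_trans (modulusD _ _ _) _; exact: lerD.
  - by rewrite modulusM ler_wpM2l ?modulus_ge0// ltW// hy.
rewrite mulrCA -[ltRHS]mulr1 ltr_pM2l// ltr_pdivrMr// mul1r /N (bigD1 j) //=.
by rewrite addrCA ltrDl ltr_pwDl// sumr_ge0.
Qed.

End FiniteDimensional.

(** * The characterization *)

Theorem theorem1p6 (R : realType) (K : numFieldType)
    (hK : K = R :> numFieldType \/ K = complex R :> numFieldType)
    (E : tvsType K) (hF : frechet R E) (hQ : quojection E) :
  ascoli_space R (weak E) <->
  (finite_dimensional E \/ tvs_isomorphic E (countable_power K)).
Proof.
have [S] := exists_real_scalars hK.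
have [X [f [pi [cont pi_f pi_thread pi_inj pi_joint]]]] := quojection_projections hQ.
split=> [|[fd|iso]].
- apply: (ascoli_finite_dimensional_or_power S _ _ pi_f pi_thread pi_inj pi_joint).
    by move=> n; have [] := cont n.
  by move=> n; have [] := cont n.
- apply: (finite_dimensional_ascoli S fd) => x x0.
  have [n pix] : exists n, pi n x <> 0.
    apply: contrapT => h; apply: x0; apply: pi_inj => n.
    by apply: contrapT => h'; apply: h; exists n.
  have sp := modulus_norm_seminorm S (pi n).
  have [|g gp gx] := hahn_banach sp (x0 := x).
    by rewrite modulus_eq0 normr_eq0; apply/eqP.
  by exists g => //; exact: dominated_continuous (cont n).2 gp.
- exact: power_ascoli S _ iso.
Qed.
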